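(* Let $q$ be an odd prime and let $B=\{b_1,\ldots,b_l\}$ be a finite set of nonzero integers with $|B|<q+1$. If $B$ satisfies one of the following conditions, then $B$ contains a perfect $q^{th}$ power: (1) $B$ contains a $q^{th}$ power modulo almost every prime; (2) for every prime $p\ne q$ not dividing $\prod_{j=1}^{l}b_j$, the set $B$ contains a $q^{th}$ power modulo $p$; (3) $k\ge 2$ and the set of hyperplanes in $\mathbb{F}_q^k$ associated with $B$ contains a linear covering of $\mathbb{F}_q^k$. More specifically, a set $B$ of nonzero integers with cardinality less than $q+1$ contains a $q^{th}$ power modulo almost every prime if and only if $B$ contains a perfect $q^{th}$ power.
   Context: A perfect $q^{th}$ power is an integer of the form $d^q$ with $d\in\mathbb{Z}$. A set $B$ contains a $q^{th}$ power modulo a prime $p$ if there are $b\in B$ and $x\in\mathbb{Z}$ with $x^q\equiv b\pmod p$; ''modulo almost every prime'' means for all but finitely many primes $p$. For a positive integer $b=\prod_{i=1}^{m}r_i^{a_i}$ (prime factorization), its $q$-free part is $\mathrm{rad}_q(b):=\prod_{i=1}^m r_i^{a_i\bmod q}$ with $a_i\bmod q\in\{0,\ldots,q-1\}$. Let $p_1,\ldots,p_k$ be all the distinct primes dividing at least one of the integers $\mathrm{rad}_q(|b_j|)$, $1\le j\le l$, and let $\nu_{ij}\ge0$ be the exact exponent of $p_i$ in $\mathrm{rad}_q(|b_j|)$. The set of hyperplanes in $\mathbb{F}_q^k$ associated with $B$ is $\big\{\sum_{i=1}^k\nu_{ij}x_i=0:1\le j\le l\big\}$, each equation being identified with its solution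 set in $\mathbb{F}_q^k$. A linear covering of a vector space $V$ of dimension at least $2$ is a collection of proper linear subspaces of $V$ whose union is $V$. *)

(* Defs.v *)
From HB Require Import structures.
From mathcomp Require Import all_boot all_order all_algebra.
From mathcomp Require Import finmap.

Set Implicit Arguments.
Unset Strict Implicit.
Unset Printing Implicit Defensive.

Import Order.TTheory GRing.Theory Num.Theory.

Local Open Scope ring_scope.
Local Open Scope fset_scope.

Definition perfect_power (q : nat) (b : int) : Prop :=
  exists d : int, b = d ^+ q.

Definition contains_perfect_power (q : nat) (B : {fset int}) : Prop :=
  exists2 b, b \in B & perfect_power q b.

Definition contains_power_mod (q : nat) (B : {fset int}) (p : nat) : Prop :=
  exists2 b, b \in B & exists x : int, (x ^+ q = b %[mod p])%Z.

Definition for_almost_every_prime (P : nat -> Prop) : Prop :=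
  exists S : {fset nat}, forall p : nat, prime p -> p \notin S -> P p.

(* The q-free part rad_q(n) of a positive integer n. *)
Definition qfree_part (q n : nat) : nat :=
  (\prod_(r <- primes n) r ^ (logn r n %% q))%N.

(* p_1, ..., p_k: the distinct primes dividing some rad_q(|b|), b in B.  Their
   order is immaterial: it only permutes the coordinates of F_q^k. *)
Definition assoc_primes (q : nat) (B : {fset int}) : seq nat :=
  undup (flatten [seq primes (qfree_part q `|b|%N) | b <- enum_fset B]).

Definition assoc_dim (q : nat) (B : {fset int}) : nat :=
  size (assoc_primes q B).

(* nu_{ij}, with the integer b = b_j itself in place of its index j. *)
Definition assoc_exp (q : nat) (B : {fset int}) (b : int)
    (i : 'I_(assoc_dim q B)) : nat :=
  logn (tnth (in_tuple (assoc_primes q B)) i) (qfree_part q `|b|%N).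

Definition assoc_hyperplane (q : nat) (B : {fset int}) (b : int) :
    {vspace 'rV['F_q]_(assoc_dim q B)} :=
  lker (linfun (mulmxr (\col_i (assoc_exp b i)%:R : 'cV['F_q]_(assoc_dim q B)))).

Lemma mem_assoc_hyperplane (q : nat) (B : {fset int}) (b : int)
    (x : 'rV['F_q]_(assoc_dim q B)) :
  (x \in assoc_hyperplane q B b) = (\sum_i (assoc_exp b i)%:R * x 0 i == 0).
Proof.
rewrite memv_ker lfunE /=; set s := \sum_i _.
have -> : x *m \col_i (assoc_exp b i)%:R = s%:M.
  apply/matrixP=> i j; rewrite !ord1 !mxE eqxx mulr1n /s.
  by apply: eq_bigr => h _; rewrite !mxE mulrC.
apply/eqP/eqP => [/matrixP/(_ 0 0)|->]; last exact: raddf0.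
by rewrite !mxE eqxx mulr1n.
Qed.

(* The solution set need not be a proper subspace: it is all of F_q^k when
   every exponent of b vanishes. *)
Definition assoc_hyperplanes (q : nat) (B : {fset int}) :
    {fset {vspace 'rV['F_q]_(assoc_dim q B)}} :=
  [fset assoc_hyperplane q B b | b in B].

Definition linear_covering (F : fieldType) (V : vectType F)
    (C : {pred {vspace V}}) : Prop :=
  [/\ (2 <= \dim {:V})%N,
      forall U : {vspace V}, U \in C -> U != fullv
    & forall v : V, exists2 U : {vspace V}, U \in C & v \in U].

Definition contains_linear_covering (F : fieldType) (V : vectType F)
    (H : {fset {vspace V}}) : Prop :=
  exists2 C : {fset {vspace V}}, (C `<=` H)%fset & linear_covering [in C].

(* Main.v *)
(* Let [K] be a field [Q[X] / (f)] of degree [d], with [f] monic and integral. Its norm form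
   is at most [c h^d] in absolute value on vectors of height [h], and a vector vanishing at
   a root of [f] modulo [p] has norm divisible by [p]. This replaces ideal theory twice.

   Upper bound: every choice of roots of [f] modulo the primes of a squarefree [n] is
   annihilated by a nonzero vector of height at most [n^(1/d)], whose norm is a bounded
   multiple of [n]. Counting vectors gives [prod_p (1 + rho(p) p^-s) = O(1 / (s - 1))],
   where [rho(p)] is the number of roots of [f] modulo [p].

   Lower bound: if the sum of [1 / p] over the primes modulo which [f] has a root
   converged, a sieve in a cube would leave a positive proportion of vectors whose norm has
   only small prime factors, which is too many. So that sum diverges.

   Suppose now that [B] has [m <= q] elements, none of them a [q]-th power, and meets the
   [q]-th powers modulo almost every prime. Apply the upper bound to the [m] irreducible
   polynomials [X^q - b]. Modulo a prime [p] not congruent to 1 modulo [q] each of them has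
   a root, and for the other [p] one of them has [q] roots. Since [m <= q], the product over
   [b] of the Euler products dominates [zeta(s)^m] times the product of [1 + p^-s] over the
   primes modulo which all the [X^q - b] split. The latter thus stays bounded as [s] tends
   to 1, against the lower bound for a field that contains the [q]-th roots of unity and of
   the elements of [B].

   Condition (3) never holds: [q] proper subspaces cannot cover a vector space over [F_q]. *)

Require Import Defs.
From HB Require Import structures.
From mathcomp Require Import all_boot all_order all_algebra all_fingroup all_field.
From mathcomp Require Import finmap zify ring lra.
From mathcomp Require Import boolp reals exp Rstruct.

Set Implicit Arguments.
Unset Strict Implicit.
Unset Printing Implicit Defensive.

Import Order.TTheory GRing.Theory Num.Theory.

Local Open Scope ring_scope.

(** * Norm forms *)

(** When [char_poly C] is irreducible, the rational polynomials in [C] form the field [Q[X] /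
    (char_poly C)], and this determinant is the norm of the element with coordinates [a] in the
    basis of powers of [X]. *)
Definition norm_form (n : nat) (C : 'M[int]_n.+1) (a : 'rV[int]_n.+1) : int :=
  \det (horner_mx C (rVpoly a)).

Definition irreducible_over_rat (f : {poly int}) : Prop :=
  irreducible_poly (map_poly intr f : {poly rat}).

(** The polynomial of [a] has smaller degree than the irreducible [f], so a Bezout relation inverts
    it modulo [f], and Cayley-Hamilton turns this into an inverse matrix over [rat]. *)
Lemma norm_form_neq0 n (C : 'M[int]_n.+1) (a : 'rV[int]_n.+1) :
  irreducible_over_rat (char_poly C) -> a != 0 -> norm_form C a != 0.
Proof.
move=> irrf a0; set f := map_poly intr (char_poly C) : {poly rat}.
set p := map_poly intr (rVpoly a) : {poly rat}.
have p0 : p != 0.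
  rewrite map_poly_eq0_id0 ?intr_eq0 ?lead_coef_eq0 //;
  by apply: contra a0 => /eqP h; apply/eqP; rewrite -[a]rVpolyK h linear0.
have szp : (size p < size f)%N.
  have -> : size f = n.+2.
    rewrite size_map_inj_poly ?size_char_poly //; exact: intr_inj.
  by rewrite ltnS (leq_trans (size_poly _ _)) // size_poly.
have cop : coprimep f p.
  have [_ /(_ (gcdp f p)) H] := irrf.
  apply/negPn/negP => nc.
  have := H nc (dvdp_gcdl _ _) => /eqp_dvdl e.
  have : f %| p by rewrite -e dvdp_gcdr.
  by move/(dvdp_leq p0); rewrite leqNgt szp.
have [[u v] /= uv] := Bezout_eq1_coprimepP _ _ cop.
have cp : f = char_poly (map_mx intr C : 'M[rat]_n.+1) by rewrite /f map_char_poly.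
have E : horner_mx (map_mx intr C : 'M[rat]_n.+1) p \is a GRing.unit.
  move/(congr1 (horner_mx (map_mx intr C))): uv.
  rewrite rmorph1 rmorphD !rmorphM /= cp Cayley_Hamilton mulr0 add0r => e.
  apply/unitrP; exists (horner_mx (map_mx intr C : 'M[rat]_n.+1) v); split=> //.
  by rewrite -rmorphM mulrC rmorphM.
move: E; rewrite -map_horner_mx unitmxE det_map_mx unitfE intr_eq0. exact.
Qed.

(** [B] dominates every entry of the powers of [C] involved, so the entries of the matrix are at
    most [h * B], and the Leibniz formula has [n.+1] factorial terms. *)
Lemma norm_form_bound n (C : 'M[int]_n.+1) :
  exists2 c : nat, (0 < c)%N & forall (a : 'rV[int]_n.+1) (h : nat),
    (forall i, `|a 0 i| <= h%:Z) -> (absz (norm_form C a) <= c * h ^ n.+1)%N.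
Proof.
pose B := \sum_(k < n.+1) \sum_i \sum_j `|(C ^+ k) i j|.
have B0 : 0 <= B by rewrite !sumr_ge0 // => *; rewrite !sumr_ge0 // => *; rewrite !sumr_ge0.
have entry (a : 'rV[int]_n.+1) (h : nat) i j : (forall i, `|a 0 i| <= h%:Z) ->
    `|horner_mx C (rVpoly a) i j| <= h%:Z * B.
  move=> ha; rewrite [rVpoly a]/rVpoly poly_def rmorph_sum /= summxE.
  apply: le_trans (ler_norm_sum _ _ _) _; rewrite mulr_sumr ler_sum // => k _.
  case: insubP => [k' _ Ek|]; last by rewrite ltn_ord.
  have -> : k' = k by apply: val_inj.
  rewrite linearZ /= rmorphXn /= horner_mx_X mxE normrM.
  apply: ler_pM => //. rewrite (bigD1 i) //= (bigD1 j) //= -addrA lerDl.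
  by rewrite addr_ge0 // !sumr_ge0 // => *; rewrite sumr_ge0.
exists (((n.+1)`! * (absz B) ^ n.+1).+1)%N => // a h ha.
apply: (@leq_trans ((n.+1)`! * (absz B) ^ n.+1 * h ^ n.+1)); last by rewrite leq_mul2r leqnSn orbT.
rewrite -lez_nat abszE /norm_form /determinant.
apply: le_trans (ler_norm_sum _ _ _) _.
have -> : Posz ((n.+1)`! * (absz B) ^ n.+1 * h ^ n.+1) = \sum_(s : 'S_n.+1) (h%:Z * B) ^+ n.+1.
  have -> : h%:Z * B = (h * absz B)%N by rewrite PoszM gez0_abs.
  rewrite sumr_const card_Sn -mulr_natl natz -mulnA -expnMn PoszM mulnC.
  by rewrite -!natz natrX mulrC.
apply: ler_sum => s _; rewrite normrM normrX normrN1 expr1n mul1r normr_prod.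
rewrite -[X in _ <= _ ^+ X]card_ord -prodr_const.
by apply: ler_prod => i _; rewrite normr_ge0 entry.
Qed.

(** * Common roots modulo a prime and divisibility of the norm *)

Lemma intr_Fp_eq0 p (z : int) :
  prime p -> (z%:~R == 0 :> 'F_p) = (p %| absz z)%N.
Proof. by move=> pp; rewrite -(dvdz_pcharf (pchar_Fp pp)). Qed.

(** [W] lifts row operations that bring [A] modulo [p] to echelon shape: the rows of [W *m A] from
    index [r] on are divisible by [p], and each gives up a factor [p]. The determinant of [W] is
    prime to [p]. *)
Lemma dvdz_det_corank p n (A : 'M[int]_n) :
  prime p ->
  (p ^ (n - \rank (map_mx intr A : 'M['F_p]_n)) %| absz (\det A))%N.
Proof.
move=> pp; set Ap := map_mx intr A : 'M['F_p]_n; set r := \rank Ap.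
pose W : 'M[int]_n := map_mx (fun x : 'F_p => (x : nat)%:Z) (invmx (col_ebase Ap)).
have WE : map_mx intr W = invmx (col_ebase Ap).
  apply/matrixP=> i j; rewrite !mxE /= -pmulrn; exact: natr_Zp.
have dW : ~~ (p %| absz (\det W))%N.
  by rewrite -intr_Fp_eq0 // -det_map_mx WE -unitfE -unitmxE unitmx_inv col_ebase_unit.
have WA (i j : 'I_n) : (r <= i)%N -> (p %| absz ((W *m A) i j))%N.
  move=> ri; rewrite -intr_Fp_eq0 //.
  have -> : ((W *m A) i j)%:~R = (map_mx intr (W *m A) : 'M['F_p]_n) i j by rewrite [RHS]mxE.
  rewrite map_mxM WE -/Ap -{2}[Ap]mulmx_ebase -mulmxA mulKmx ?col_ebase_unit // -/r.
  rewrite mxE big1 // => k _; rewrite !mxE; case: (_ =P _) => [e|_]; last by rewrite mul0r.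
  by rewrite ltnNge -/r ri /= mul0r.
pose D : 'rV[int]_n := \row_i if (i < r)%N then 1 else p%:Z.
pose A' := \matrix_(i, j) if (i < r)%N then (W *m A) i j else ((W *m A) i j %/ p)%Z.
have E : W *m A = diag_mx D *m A'.
  apply/matrixP=> i j; rewrite mul_diag_mx [RHS]mxE [A' i j]mxE [D 0 i]mxE.
  case: ltnP => ri; first by rewrite mul1r.
  by rewrite mulrC divzK // dvdzE /=; apply: WA.
have dD : \det (diag_mx D) = (p ^ (n - r))%N%:Z.
  rewrite det_diag (eq_bigr (fun i : 'I_n => if (i < r)%N then 1 else p%:Z)); last first.
    by move=> i _; rewrite mxE.
  rewrite -(big_mkord predT (fun i => if (i < r)%N then 1 else p%:Z)).
  rewrite (big_cat_nat (n := r)) ?rank_leq_row //= big_nat_cond big1 ?mul1r; last first.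
    by move=> i /andP[/andP[_ ->]].
  rewrite big_nat_cond (eq_bigr (fun=> p%:Z)) -?big_nat_cond; last first.
    by move=> i /andP[/andP[ri _] _]; rewrite ltnNge ri.
  by rewrite prodr_const_nat -!natz natrX.
have : (p ^ (n - r) %| absz (\det W) * absz (\det A))%N.
  by rewrite -abszM -det_mulmx E det_mulmx dD abszM dvdn_mulr.
by rewrite Gauss_dvdr // coprimeXl // prime_coprime.
Qed.

Section CommonRoots.

Variables (p n : nat) (E : fieldType) (phi : {rmorphism 'F_p -> E}).
Hypothesis p_prime : prime p.
Variables (C : 'M[int]_n.+1) (a : 'rV[int]_n.+1).

Definition common_root (rho : E) : bool :=
  root (map_poly intr (char_poly C)) rho && root (map_poly intr (rVpoly a)) rho.

Let CE : 'M[E]_n.+1 := map_mx intr C.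

(** On an eigenvector of [C] for [rho], a polynomial in [C] acts as its value at [rho]. *)
Let eigenspace_sub_ker rho : common_root rho ->
  (eigenspace CE rho <= kermx (horner_mx CE (map_poly intr (rVpoly a))))%MS.
Proof.
case/andP=> _ /eqP ra; apply/sub_kermxP/row_matrixP=> i; rewrite row0 row_mul.
set v := row i _.
have vC : v *m CE = rho *: v by apply/eigenspaceP; rewrite row_sub.
have vp (g : {poly E}) : v *m horner_mx CE g = g.[rho] *: v.
  elim/poly_ind: g => [|g c IH]; first by rewrite rmorph0 mulmx0 horner0 scale0r.
  rewrite rmorphD rmorphM /= horner_mx_X horner_mx_C -mulmxE mulmxDr mulmxA IH.
  by rewrite -scalemxAl vC scalerA mul_mx_scalar hornerMXaddC scalerDl.
by rewrite vp ra scale0r.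
Qed.

Let eigenspace_gt0 rho : common_root rho -> (0 < \rank (eigenspace CE rho))%N.
Proof.
case/andP=> rC _; have : eigenvalue CE rho by rewrite eigenvalue_root_char -map_char_poly.
by rewrite lt0n mxrank_eq0.
Qed.

(** The rank over ['F_p] is unchanged in the extension [E], so the corank may be read there. *)
Let dvd_norm k :
  (k <= \rank (kermx (horner_mx CE (map_poly intr (rVpoly a)))))%N ->
  (p ^ k %| absz (norm_form C a))%N.
Proof.
rewrite mxrank_ker => hk; apply: dvdn_trans (dvdz_det_corank _ p_prime).
apply: dvdn_exp2l; apply: leq_trans hk _; rewrite leq_sub2l // eq_leq //.
rewrite -map_horner_mx -(mxrank_map phi) -map_mx_comp.
by congr mxrank; apply/matrixP=> i j; rewrite !mxE /= rmorph_int.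
Qed.

Lemma common_root_dvd_norm rho : common_root rho -> (p %| absz (norm_form C a))%N.
Proof.
move=> cr; rewrite -[p]expn1; apply: dvd_norm.
exact: leq_trans (eigenspace_gt0 cr) (mxrankS (eigenspace_sub_ker cr)).
Qed.

(** Eigenspaces for distinct eigenvalues meet trivially, which makes the corank at least 2. *)
Lemma common_roots_dvd_norm rho1 rho2 : rho1 != rho2 ->
  common_root rho1 -> common_root rho2 -> (p ^ 2 %| absz (norm_form C a))%N.
Proof.
move=> ne c1 c2; apply: dvd_norm.
have : (eigenspace CE rho1 + eigenspace CE rho2 <=
        kermx (horner_mx CE (map_poly intr (rVpoly a))))%MS.
  by rewrite addsmx_sub !eigenspace_sub_ker.
move/mxrankS; apply: leq_trans.
rewrite mxrank_disjoint_sum; first by rewrite -[2%N]/(1 + 1)%N leq_add ?eigenspace_gt0.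
apply/eqP; rewrite -submx0; apply/row_subP => i; set v := row i _.
have : (v <= eigenspace CE rho1 :&: eigenspace CE rho2)%MS by rewrite row_sub.
rewrite sub_capmx => /andP[/eigenspaceP v1 /eigenspaceP v2].
move: v2; rewrite v1 => /eqP; rewrite -subr_eq0 -scalerBl scaler_eq0 subr_eq0.
by rewrite (negPf ne) /= => /eqP->; rewrite sub0mx.
Qed.

End CommonRoots.

(** Over [E] the polynomial [g] of [a] splits, so its value at [C] is a scalar times a product of
    factors [C - z]. If the product is singular, so is a factor, and its [z] is an eigenvalue of
    [C]. *)
Lemma norm_dvd_common_root p n (E : closedFieldType) (phi : {rmorphism 'F_p -> E})
    (C : 'M[int]_n.+1) (a : 'rV[int]_n.+1) :
  prime p -> (p %| absz (norm_form C a))%N -> exists rho : E, common_root C a rho.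
Proof.
move=> pp; rewrite -intr_Fp_eq0 // -(fmorph_eq0 phi) rmorph_int.
rewrite /norm_form -det_map_mx map_horner_mx; set CE := map_mx _ C.
set g := map_poly _ _; move=> d0; rewrite /common_root -/g map_char_poly -/CE.
have [g0|g0] := eqVneq g 0.
  have [z rz] : exists z, root (char_poly CE) z.
    by apply/closed_rootP; rewrite size_char_poly.
  by exists z; rewrite rz g0 root0.
have [rs Dg] := closed_field_poly_normal g.
suff [z zrs rz] : exists2 z, z \in rs & root (char_poly CE) z.
  by exists z; rewrite rz Dg rootZ ?lead_coef_eq0 //= root_prod_XsubC.
move: d0; rewrite {1}Dg linearZ /= rmorph_prod detZ mulf_eq0 expf_eq0 lead_coef_eq0 (negPf g0) /=.
elim: rs {Dg} => [|z rs IH]; first by rewrite big_nil det1 oner_eq0.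
rewrite big_cons det_mulmx mulf_eq0 => /orP[dz|/IH[w wrs rw]]; last first.
  by exists w => //; rewrite inE wrs orbT.
exists z; first by rewrite inE eqxx.
rewrite -eigenvalue_root_char /eigenvalue /eigenspace kermx_eq0 row_free_unit.
by move: dz; rewrite rmorphB /= horner_mx_X horner_mx_C unitmxE unitfE negbK.
Qed.

(** * Short vectors in the lattices of residue vectors *)

Lemma horner_rVpoly (R : nzRingType) d (a : 'rV[R]_d) x :
  (rVpoly a).[x] = \sum_i a 0 i * x ^+ i.
Proof.
rewrite /rVpoly horner_poly; apply: eq_bigr => i _.
by case: insubP => [j _ ij|]; rewrite ?ltn_ord //; congr (a 0 _ * _); apply: val_inj.
Qed.

(* A valid selection stands for an ideal with squarefree cyclic quotient: [g p = Some r]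
   puts the prime [p] in the modulus and selects the root [r] of [f] modulo [p]. *)
Definition root_selection N := {ffun 'I_N -> option 'I_N}.

Definition selection_modulus N (g : root_selection N) : nat :=
  (\prod_(p : 'I_N | g p) p)%N.

Definition valid_selection (f : {poly int}) N (g : root_selection N) : bool :=
  [forall p : 'I_N, if g p is Some r
    then [&& prime p, (r < p)%N & (p %| absz f.[r%:Z])%N] else true].

Lemma valid_selectionP f N (g : root_selection N) (p r : 'I_N) :
  valid_selection f g -> g p = Some r ->
  [/\ prime p, (r < p)%N & (p %| absz f.[r%:Z])%N].
Proof. by move=> /forallP/(_ p) + gp; rewrite gp => /and3P[]. Qed.

Lemma selection_modulus_gt0 f N (g : root_selection N) :
  valid_selection f g -> (0 < selection_modulus g)%N.
Proof.
move=> vg; apply: prodn_cond_gt0 => p; case gp: (g p) => [r|] // _.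
by have [/prime_gt0] := valid_selectionP vg gp.
Qed.

Lemma dvdn_selection_modulus f N (g : root_selection N) (p : 'I_N) :
  valid_selection f g -> prime p -> (p %| selection_modulus g)%N = g p.
Proof.
move=> vg pp; apply/idP/idP => [|gp]; last by rewrite /selection_modulus (bigD1 p) //= dvdn_mulr.
rewrite /selection_modulus Euclid_dvd_prod // big_orE => /existsP[/= r /andP[gr]].
case Er: (g r) gr => [s|] // _; have [pr _ _] := valid_selectionP vg Er.
by rewrite dvdn_prime2 // => /eqP/val_inj->; rewrite Er.
Qed.

Lemma dvdn_selection_cofactor f N (g : root_selection N) (p : 'I_N) m :
  valid_selection f g -> prime p -> g p ->
  (p ^ 2 %| selection_modulus g * m)%N -> (p %| m)%N.
Proof.
move=> vg pp gp; rewrite /selection_modulus (bigD1 p) //= -mulnA expnS expn1.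
rewrite dvdn_pmul2l ?prime_gt0 // Euclid_dvdM // => /orP[|//].
rewrite Euclid_dvd_prod // big_orE => /existsP[/= r /andP[/andP[gr rp]]].
case Er: (g r) gr => [s|] // _; have [pr _ _] := valid_selectionP vg Er.
rewrite dvdn_prime2 // => /eqP e; by rewrite (val_inj e) eqxx in rp.
Qed.

(* Thue's pigeonhole argument in the lattice of the vectors that vanish at all
   the selected roots. *)
Lemma short_vector d N (g : root_selection N) k :
  (forall p, g p -> (0 < p)%N) ->
  (selection_modulus g < k.+1 ^ d)%N ->
  exists a : 'rV[int]_d, [/\ a != 0, forall i, (absz (a 0%R i) <= k)%N &
    forall p r, g p = Some r -> (p %| absz (rVpoly a).[r%:Z])%N].
Proof.
move=> g0 lt_mod.
pose res (x : {ffun 'I_d -> 'I_k.+1}) (p r : nat) := (\sum_i x i * r ^ i)%N.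
have H (x : {ffun 'I_d -> 'I_k.+1}) (p : 'I_N) :
    ((if g p is Some r then res x p r %% p else 0) < N)%N.
  case Ep: (g p) => [r|]; last exact: leq_ltn_trans (leq0n p) (ltn_ord p).
  by apply: ltn_trans (ltn_ord p); rewrite ltn_mod g0 ?Ep.
pose Res x := [ffun p => Ordinal (H x p)].
(* Where nothing is selected only the residue 0 is allowed, so the family of residue vectors has
   exactly [selection_modulus g] members. *)
pose F (p : 'I_N) : {pred 'I_N} := [pred y : 'I_N | (y < (if g p then p : nat else 1))%N].
have RF x : Res x \in family F.
  apply/familyP=> p; rewrite !inE ffunE /=; case Ep: (g p) => [r|] //=.
  by rewrite ltn_mod g0 ?Ep.
have cF : #|family F| = selection_modulus g.
  rewrite card_family foldrE big_image /= /selection_modulus [RHS]big_mkcond /=.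
  apply: eq_bigr => p _.
  have cl m : (m <= N)%N -> #|[pred y : 'I_N | (y < m)%N]| = m.
    move=> mN; rewrite -sum1_card.
    have /= E := big_ord_narrow (op := addn) (idx := 0%N) (F := fun=> 1%N) mN.
    by rewrite [LHS]E big_const_ord iter_addn mul1n addn0.
  rewrite cl //.
  by case: ifP => _; [exact: ltnW | exact: leq_ltn_trans (leq0n p) (ltn_ord p)].
have [x [y nxy Exy]] : exists x, exists2 y, x != y & Res x = Res y.
  apply/injectivePn/negP => /injectiveP inj.
  have : (#|codom Res| <= #|family F|)%N by apply/subset_leq_card/subsetP=> _ /codomP[z ->].
  by rewrite card_codom // card_ffun !card_ord cF leqNgt lt_mod.
exists (\row_i ((x i : nat)%:Z - (y i : nat)%:Z)); split.
- apply: contra nxy => /eqP/rowP xy; apply/eqP/ffunP => i; apply/val_inj.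
  by have /eqP := xy i; rewrite !mxE subr_eq0 => /eqP[].
- by move=> i; rewrite mxE; have := ltn_ord (x i); have := ltn_ord (y i); lia.
move=> p r gp; have /(congr1 (fun h : {ffun 'I_N -> 'I_N} => val (h p))) := Exy.
rewrite !ffunE /= gp => /eqP e; rewrite -[p : nat]/(absz p) -dvdzE horner_rVpoly.
have -> : \sum_i (\row_i ((x i : nat)%:Z - (y i : nat)%:Z)) 0 i * (r : nat)%:Z ^+ i =
    (res x p r)%:Z - (res y p r)%:Z :> int.
  rewrite /res -!natz !natr_sum -sumrB; apply: eq_bigr => i _.
  by rewrite mxE mulrBl !natrM !natrX !natz.
by rewrite -eqz_mod_dvd !modz_nat (eqP e).
Qed.

Definition mx_height d (a : 'rV[int]_d) : nat := \max_i absz (a 0%R i).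

Lemma le_mx_height d (a : 'rV[int]_d) i : (absz (a 0%R i) <= mx_height a)%N.
Proof. exact: leq_bigmax. Qed.

Lemma mx_height_gt0 d (a : 'rV[int]_d) : a != 0 -> (0 < mx_height a)%N.
Proof.
apply: contraNT; rewrite -leqNgt leqn0 => /eqP h0.
by apply/eqP/rowP=> i; have := le_mx_height a i; rewrite h0 leqn0 absz_eq0 mxE => /eqP.
Qed.

Lemma dvdn_modulus f N (g : root_selection N) x :
  valid_selection f g -> (forall p, g p -> (p %| x)%N) -> (selection_modulus g %| x)%N.
Proof.
move=> vg dx; rewrite /selection_modulus.
elim: (index_enum _) (index_enum_uniq 'I_N) => [|p s IH]; first by rewrite big_nil dvd1n.
rewrite big_cons /= => /andP[ps us]; case Ep: (g p) => [r|] /=; last exact: IH.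
have [pp _ _] := valid_selectionP vg Ep.
rewrite Gauss_dvd ?IH // ?andbT ?dx ?Ep //.
  rewrite prime_coprime // Euclid_dvd_prod // -big_filter big_has; apply/hasP.
  move=> [q]; rewrite mem_filter => /andP[gq qs].
  case Eq: (g q) gq => [t|] // _; have [pq _ _] := valid_selectionP vg Eq.
  by rewrite dvdn_prime2 // => /eqP/val_inj e; rewrite e qs in ps.
Qed.

Lemma valid_selection_vector f N (g : root_selection N) n :
  valid_selection f g -> exists a : 'rV[int]_n.+1,
  [/\ a != 0, (mx_height a ^ n.+1 <= selection_modulus g)%N &
    forall p r, g p = Some r -> (p %| absz (rVpoly a).[r%:Z])%N].
Proof.
move=> vg; set M := selection_modulus g; have M0 := selection_modulus_gt0 vg.
have exk : exists k, (k ^ n.+1 <= M)%N by exists 0%N; rewrite exp0n.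
have ubk k : (k ^ n.+1 <= M)%N -> (k <= M)%N.
  by case: k => // k; apply: leq_trans; rewrite -{1}[k.+1]expn1 leq_pexp2l.
(* By maximality the modulus is below [k.+1 ^ n.+1], as the pigeonhole argument requires. *)
have [k kM Hk] := ex_maxnP exk ubk.
have [||a [a0 ak ag]] := @short_vector n.+1 N g k.
- by move=> p; case Ep: (g p) => [r|] // _; case: (valid_selectionP vg Ep) => /prime_gt0.
- by rewrite ltnNge; apply/negP => /Hk; rewrite ltnn.
exists a; split=> //; apply: leq_trans kM; rewrite leq_exp2r //.
by apply/bigmax_leqP => i _; apply: ak.
Qed.

(* A selection is recovered from its short vector [a], the cofactor [m <= c] of its modulus
   in the norm of [a], and its values at the primes [p <= c]: two common roots of [a] and
   the characteristic polynomial modulo [p] give [p ^ 2 %| norm], so [p %| m]. *)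
Lemma selections_by_height n (C : 'M[int]_n.+1) :
  irreducible_over_rat (char_poly C) ->
  exists2 K : nat, (0 < K)%N & forall N, exists h : root_selection N -> nat,
    (forall g, valid_selection (char_poly C) g ->
       (0 < h g)%N /\ (h g ^ n.+1 <= selection_modulus g)%N) /\
    (forall k, (0 < k)%N ->
       (#|[set g | valid_selection (char_poly C) g & h g == k]| <= K * k ^ n)%N).
Proof.
move=> irr; set f := char_poly C; have [c c0 Hc] := norm_form_bound C.
pose T := {ffun 'I_c.+1 -> option 'I_c.+1}.
(* The factors count the codes below: position and sign of an entry of maximal size, the other [n]
   entries with at most [2 * k.+1 <= 4 * k] signed values each, the cofactor, and the selection at
   the primes up to [c]. *)
exists (n.+1 * 2 * 4 ^ n * c.+1 * #|{: T}|)%N.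
  by rewrite !muln_gt0 expn_gt0 /=; apply/card_gt0P; exists [ffun=> None].
move=> N.
have /fin_all_exists[a Ha] (g : root_selection N) : exists a : 'rV[int]_n.+1,
    valid_selection f g -> [/\ a != 0, (mx_height a ^ n.+1 <= selection_modulus g)%N &
    forall p r, g p = Some r -> (p %| absz (rVpoly a).[r%:Z])%N].
  have [vg|_] := boolP (valid_selection f g); last by exists 0.
  by have [a Ha] := valid_selection_vector n vg; exists a.
exists (fun g => mx_height (a g)); split=> [g /Ha[a0 ha _]|k k0].
  by rewrite mx_height_gt0.
have cr (g : root_selection N) (p r : 'I_N) : valid_selection f g -> g p = Some r ->
    common_root C (a g) (r%:R : 'F_p).
  move=> vg gp; have [pp rp fr] := valid_selectionP vg gp; have [_ _ /(_ p r gp) ar] := Ha g vg.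
  by rewrite /common_root /root -[r%:R]/(r%:Z%:~R) !horner_map /= !intr_Fp_eq0 // fr.
have Hm g : valid_selection f g -> exists2 m : 'I_c.+1,
    absz (norm_form C (a g)) = (selection_modulus g * m)%N & (0 < m)%N.
  move=> vg; have [a0 ha ga] := Ha g vg.
  have : (selection_modulus g %| absz (norm_form C (a g)))%N.
    apply: (dvdn_modulus vg) => p; case Ep: (g p) => [r|] // _.
    have [pp _ _] := valid_selectionP vg Ep.
    exact: (common_root_dvd_norm idfun pp (cr _ _ _ vg Ep)).
  case/dvdnP=> m Em; have m0 : (0 < m)%N.
    rewrite lt0n; apply: contraTneq isT => m0; have := norm_form_neq0 irr a0.
    by rewrite -absz_eq0 Em m0.
  have mc : (m < c.+1)%N.
    rewrite ltnS -(leq_pmul2r (selection_modulus_gt0 vg)) -Em.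
    apply: leq_trans (Hc _ (mx_height (a g)) _) _; last by rewrite leq_mul2l ha orbT.
    by move=> i; rewrite -abszE lez_nat le_mx_height.
  by exists (Ordinal mc); rewrite // Em mulnC.
have /fin_all_exists[m {}Hm] (g : root_selection N) : exists m : 'I_c.+1,
    valid_selection f g ->
    absz (norm_form C (a g)) = (selection_modulus g * m)%N /\ (0 < m)%N.
  have [/Hm[m Em m0]|_] := boolP (valid_selection f g); last by exists ord0.
  by exists m.
pose small (g : root_selection N) : T := [ffun p : 'I_c.+1 =>
  if insub (val p) is Some p' then omap (fun r : 'I_N => inord r) (g p') else None].
have amax (g : root_selection N) : exists i, absz (a g 0 i) = mx_height (a g).
  have [|i Ei] := @bigop.eq_bigmax 'I_n.+1 (fun i => absz (a g 0 i)); first by rewrite card_ord.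
  by exists i; rewrite -Ei.
have /fin_all_exists[i0 Hi0] := amax.
pose code (g : root_selection N) := (i0 g, a g 0 (i0 g) < 0,
  [ffun j : 'I_n => (a g 0 (lift (i0 g) j) < 0, inord (absz (a g 0 (lift (i0 g) j))) : 'I_k.+1)],
  m g, small g).
rewrite -(@card_in_imset _ _ code).
  apply: leq_trans (max_card _) _.
  rewrite !card_prod card_ffun card_prod !card_ord card_bool.
  apply: (@leq_trans (n.+1 * 2 * (4 ^ n * k ^ n) * c.+1 * #|{: T}|)); last by apply: eq_leq; ring.
  rewrite !leq_mul // -expnMn; case: (n) => // n'; rewrite leq_exp2r //; lia.
move=> g g'; rewrite !inE => /andP[vg /eqP hg] /andP[vg' /eqP hg'].
rewrite /code => -[ei es ea em esm].
have Ea : a g = a g'.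
  have inj (z w : int) : absz z = absz w -> (z < 0) = (w < 0) -> z = w by lia.
  apply/rowP => i; case: (unliftP (i0 g) i) => [j|] ->; last first.
    by apply: inj; rewrite ?es ?Hi0 ?ei ?Hi0 ?hg ?hg'.
  move/ffunP/(_ j): ea; rewrite !ffunE -ei => -[sj aj]; apply: inj => //.
  have le g1 : mx_height (a g1) = k -> (absz (a g1 0%R (lift (i0 g) j)) < k.+1)%N.
    by move=> <-; rewrite ltnS le_mx_height.
  by move/(congr1 val): aj; rewrite /= !inordK ?le.
have Emod : selection_modulus g = selection_modulus g'.
  have [Em m0] := Hm g vg; have [Em' _] := Hm g' vg'.
  by apply/eqP; rewrite -(eqn_pmul2r m0) -Em Ea Em' em.
have smallE (p r : 'I_N) g1 : valid_selection f g1 -> (p <= c)%N -> g1 p = Some r ->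
    exists2 s : 'I_c.+1, small g1 (inord p) = Some s & val s = val r.
  move=> v1 pc g1p; have [_ rp _] := valid_selectionP v1 g1p.
  have rc : (r < c.+1)%N by rewrite ltnS (leq_trans (ltnW rp)).
  exists (inord r); last by rewrite /= inordK.
  by rewrite ffunE /= inordK // insubT //= => p'; rewrite (_ : Sub _ _ = p) ?g1p //; apply: val_inj.
apply/ffunP => p; have := dvdn_selection_modulus vg; have := dvdn_selection_modulus vg'.
move=> /(_ p) d' /(_ p) d; case Ep: (g p) => [r|]; case Ep': (g' p) => [r'|] //.
- have [pp rp _] := valid_selectionP vg Ep; have [_ rp' _] := valid_selectionP vg' Ep'.
  congr Some; apply/val_inj; have [pc|cp] := leqP p c.
    have [s] := smallE _ _ _ vg pc Ep; have [s'] := smallE _ _ _ vg' pc Ep'.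
    by rewrite esm => -> <- [->] <-.
  apply/eqP/negPn/negP => rr'.
  have ne : (r%:R : 'F_p) != r'%:R.
    apply: contra rr' => /eqP/(congr1 val); rewrite /= !val_Fp_nat // !modn_small //.
    by move=> ->.
  have cr1 := cr _ _ _ vg Ep; have := cr _ _ _ vg' Ep'; rewrite -Ea => cr2.
  have := common_roots_dvd_norm idfun pp ne cr1 cr2.
  have [Em m0] := Hm g vg; rewrite Em => /(dvdn_selection_cofactor vg pp).
  rewrite Ep => /(_ isT) /dvdn_leq - /(_ m0) pm.
  by have := leq_trans cp pm; rewrite ltnNge -ltnS ltn_ord.
- have [pp rp _] := valid_selectionP vg Ep.
  by have := d pp; rewrite Emod d' // Ep Ep'.
- have [pp rp _] := valid_selectionP vg' Ep'.
  by have := d pp; rewrite Emod d' // Ep Ep'.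
Qed.

(** * Euler products *)

Lemma ler_sum_inj (R : numDomainType) (I J : finType) (P : pred I) (Q : pred J)
    (h : I -> J) (F : I -> R) (G : J -> R) :
  {in P &, injective h} -> (forall i, P i -> Q (h i)) ->
  (forall j, Q j -> 0 <= G j) -> (forall i, P i -> F i <= G (h i)) ->
  \sum_(i | P i) F i <= \sum_(j | Q j) G j.
Proof.
move=> injh PQ G0 FG.
apply: (@le_trans _ _ (\sum_(i | P i) G (h i))); first exact: ler_sum.
rewrite -(@big_imset _ _ _ _ _ h [pred i | P i] G) //=.
rewrite [leRHS](bigID [in h @: [pred i | P i]]) /=.
rewrite [X in _ <= X + _](eq_bigl [in h @: [pred i | P i]]); last first.
  move=> j /=; apply/andP/idP => [[]//|/imsetP[i Pi ->]].
  by split; [apply: PQ | apply: imset_f].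
by rewrite lerDl sumr_ge0 // => j /andP[/G0].
Qed.

Section Weights.

Variable R : realType.

(* [wt s k] is [k ^ - s], with [wt s 0 = 0] for [s != 0]. *)
Definition wt (s : R) (k : nat) : R := (k%:R `^ s)^-1.

Lemma wtM s : {morph wt s : a b / (a * b)%N >-> a * b}.
Proof. by move=> a b; rewrite /wt natrM powRM // invfM. Qed.

Lemma wt1 s : wt s 1 = 1.
Proof. by rewrite /wt powR1 invr1. Qed.

Lemma wt_ge0 s k : 0 <= wt s k.
Proof. by rewrite invr_ge0 powR_ge0. Qed.

Lemma wt_prod s (I : Type) (r : seq I) (P : pred I) (F : I -> nat) :
  wt s (\prod_(i <- r | P i) F i)%N = \prod_(i <- r | P i) wt s (F i).
Proof. exact: (big_morph (wt s) (wtM s) (wt1 s)). Qed.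

Lemma wtX s k n : wt s (k ^ n) = wt s k ^+ n.
Proof. by elim: n => [|n IH]; rewrite ?wt1 // expnS wtM IH exprS. Qed.

Lemma wt_le s a b : 0 <= s -> (0 < a)%N -> (a <= b)%N -> wt s b <= wt s a.
Proof.
move=> s0 a0 ab; rewrite lef_pV2 ?posrE ?powR_gt0 ?ltr0n //; last exact: leq_trans ab.
by apply: ge0_ler_powR; rewrite ?nnegrE ?ler0n // ler_nat.
Qed.

Lemma wt1DE e k : (0 < k)%N -> wt (1 + e) k = wt e k / k%:R.
Proof.
move=> k0; rewrite /wt powRD ?powRr1 ?ler0n // ?invfM 1?mulrC //.
by rewrite pnatr_eq0 -lt0n k0 implybT.
Qed.

Lemma wt1D_le e k : 0 <= e -> (0 < k)%N -> wt (1 + e) k <= k%:R^-1.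
Proof.
move=> e0 k0; rewrite wt1DE // ler_piMl ?invr_ge0 ?ler0n //.
by rewrite -(wt1 e); apply: wt_le.
Qed.

Let wt_succ e k : (0 < k)%N -> wt e k = wt e k.+1 * (1 + k%:R^-1) `^ e.
Proof.
move=> k0; have k0' : 0 < k%:R :> R by rewrite ltr0n.
rewrite /wt.
have -> : (k.+1)%:R = k%:R * (1 + k%:R^-1) :> R by rewrite mulrDr divff ?lt0r_neq0 // mulr1 -natr1.
rewrite powRM ?ler0n //; last by rewrite addr_ge0 // invr_ge0 ltW.
rewrite invfM -mulrA mulVf ?mulr1 // lt0r_neq0 // powR_gt0 //.
by rewrite addr_gt0 // invr_gt0.
Qed.

(** Uses [expR x >= 1 + x] and [ln (1 + 1/k) = - ln (1 - 1/(k+1)) >= 1/(k+1)]. *)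
Let powR_sub_ge e k : 0 <= e -> (0 < k)%N ->
  1 + e / k.+1%:R <= (1 + k%:R^-1) `^ e :> R.
Proof.
move=> e0 k0; have k0' : 0 < k%:R :> R by rewrite ltr0n.
have pos : 0 < 1 + k%:R^-1 :> R by rewrite addr_gt0 // invr_gt0.
rewrite /powR gt_eqF //; apply: le_trans (expR_ge1Dx _).
rewrite lerD2l ler_wpM2l //.
have -> : 1 + k%:R^-1 = (1 - k.+1%:R^-1)^-1 :> R.
  have k1 : k%:R + 1 != 0 :> R by rewrite lt0r_neq0 ?addr_gt0.
  have -> : 1 - k.+1%:R^-1 = k%:R / (k%:R + 1) :> R by rewrite -natr1; field.
  by rewrite invf_div; field; rewrite lt0r_neq0.
have h : 1 - k.+1%:R^-1 > 0 :> R by rewrite subr_gt0 invf_lt1 ?ltr0n // ltr1n.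
rewrite lnV ?posrE // lerNr; apply: le_trans (le_ln1Dx _) _ => //.
by rewrite ltrN2 -subr_gt0.
Qed.

Let powR_sub_le e k : 0 <= e -> (0 < k)%N ->
  1 - e / k%:R <= ((1 + k%:R^-1) `^ e)^-1 :> R.
Proof.
move=> e0 k0; have k0' : 0 < k%:R :> R by rewrite ltr0n.
have pos : 0 < 1 + k%:R^-1 :> R by rewrite addr_gt0 // invr_gt0.
rewrite /powR gt_eqF // -expRN; apply: le_trans (expR_ge1Dx _).
rewrite lerD2l lerN2 ler_wpM2l //; apply: le_ln1Dx.
by rewrite (lt_trans _ (_ : 0 < _)) // ?oppr_lt0 ?invr_gt0.
Qed.

(** Discrete form of the integral comparison: [e * wt (1 + e) k.+1 <= wt e k - wt e k.+1], and the
    right-hand side telescopes. *)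
Lemma sum_wt_le e K : 0 < e -> \sum_(1 <= k < K) wt (1 + e) k <= 1 + e^-1.
Proof.
move=> e0; case: K => [|K]; first by rewrite big_geq // addr_ge0 // invr_ge0 ltW.
suff : \sum_(1 <= k < K.+1) wt (1 + e) k <= 1 + (1 - wt e K.-1.+1) / e.
  move/le_trans; apply; rewrite lerD2l -[leRHS]mul1r ler_wpM2r ?invr_ge0 ?(ltW e0) //.
  by rewrite gerBl wt_ge0.
elim: K => [|K IH]; first by rewrite big_geq //= wt1 subrr mul0r addr0.
rewrite big_nat_recr //=; case: K IH => [|K] IH.
  by rewrite big_geq //= !wt1 subrr mul0r add0r addr0.
apply: le_trans (lerD IH (lexx _)) _ => /=.
rewrite -addrA lerD2l -lerBrDl -mulrBl ler_pdivlMr //.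
have -> : 1 - wt e K.+2 - (1 - wt e K.+1) = wt e K.+1 - wt e K.+2 by ring.
rewrite [wt e K.+1]wt_succ // wt1DE //.
have := powR_sub_ge (ltW e0) (ltn0Sn K); set u := _ `^ _ => hu.
have w0 := wt_ge0 e K.+2.
have -> : wt e K.+2 / K.+2%:R * e = wt e K.+2 * (e / K.+2%:R) by ring.
by rewrite -[X in _ - X]mulr1 -mulrBr ler_wpM2l // lerBrDl.
Qed.

(** Same telescoping, now with [wt e k - wt e k.+1 <= e * wt (1 + e) k]. *)
Lemma sum_wt_ge e K : 0 < e -> (0 < K)%N ->
  (1 - wt e K) / e <= \sum_(1 <= k < K) wt (1 + e) k.
Proof.
move=> e0; case: K => // K _; elim: K => [|K IH].
  by rewrite big_geq // wt1 subrr mul0r.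
rewrite big_nat_recr //=; apply: le_trans (lerD IH (lexx _)).
rewrite -lerBlDl -mulrBl ler_pdivrMr //.
have -> : 1 - wt e K.+2 - (1 - wt e K.+1) = wt e K.+1 - wt e K.+2 by ring.
rewrite wt1DE //; have := powR_sub_le (ltW e0) (ltn0Sn K); have E := @wt_succ e K.+1 isT.
have : 0 < (1 + K.+1%:R^-1) `^ e by rewrite powR_gt0 // addr_gt0 // invr_gt0.
set u := _ `^ _ in E *; move=> u0 hu.
have -> : wt e K.+2 = wt e K.+1 / u by rewrite E mulfK ?lt0r_neq0.
have -> : wt e K.+1 / K.+1%:R * e = wt e K.+1 * (e / K.+1%:R) by ring.
by rewrite -[X in X - _]mulr1 -mulrBr ler_wpM2l ?wt_ge0 // lerBlDr -lerBlDl.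
Qed.

Lemma wt_small e : 0 < e -> exists K0, forall K, (K0 <= K)%N -> wt e K <= 2^-1.
Proof.
move=> e0; exists (Num.bound (2 `^ (e^-1) : R)) => K hK.
have [K0 hK0] : (0 < K)%N /\ 2 `^ e^-1 <= K%:R :> R.
  have h : 2 `^ e^-1 < K%:R :> R.
    apply: lt_le_trans (_ : (Num.bound (2 `^ (e^-1) : R))%:R <= _); last by rewrite ler_nat.
    by rewrite archi_boundP // powR_ge0.
  by split; [rewrite -(ltr0n R) (le_lt_trans _ h) // powR_ge0 | exact: ltW].
rewrite lef_pV2 ?posrE ?powR_gt0 ?ltr0n //.
have -> : 2 = (2 `^ e^-1) `^ e :> R by rewrite -powRrM mulVf ?lt0r_neq0 // powRr1.
by apply: ge0_ler_powR; rewrite ?nnegrE ?powR_ge0 ?ler0n // ltW.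
Qed.

(** From [k <= 2 ^ k] follows [k ^ e <= 2 ^ (e * k) <= 2]. This transfers a bound uniform in [e] to
    the sum of [1 / p] over a finite range. *)
Lemma wt_small_exponent e k : 0 <= e -> (0 < k)%N -> e * k%:R <= 1 ->
  (2 * k%:R)^-1 <= wt (1 + e) k.
Proof.
move=> e0 k0 ek; have k0' : 0 < k%:R :> R by rewrite ltr0n.
rewrite wt1DE // invfM ler_pM2r ?invr_gt0 // lef_pV2 ?posrE ?powR_gt0 //.
have -> : 2 = 2 `^ 1 :> R by rewrite powRr1.
apply: le_trans (_ : 2 `^ (e * k%:R) <= _); last by rewrite ler_powR // ler1n.
rewrite mulrC powRrM; apply: ge0_ler_powR; rewrite ?nnegrE ?powR_ge0 ?ler0n //.
by rewrite powR_mulrn // -natrX ler_nat ltnW // ltn_expl.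
Qed.

End Weights.

(** [S N] sums over the [k < K] with all prime factors below [N]. For [N] prime, dividing the
    multiples of [N] by [N] gives [S N.+1 <= S N + S N.+1 * t N], which is solved for [S N.+1]. *)
Lemma sum_le_euler_prod (R : realFieldType) (t : nat -> R) K :
  t 1%N = 1 -> {morph t : a b / (a * b)%N >-> a * b} -> (forall k, 0 <= t k) ->
  (forall p, prime p -> t p < 1) ->
  \sum_(1 <= k < K) t k <= \prod_(0 <= p < K | prime p) (1 - t p)^-1.
Proof.
move=> t1 tM t0 tlt.
pose S N := \sum_(k < K | (0 < k)%N && all (fun p => (p < N)%N) (primes k)) t k.
have SN N : S N <= \prod_(0 <= p < N | prime p) (1 - t p)^-1.
  elim: N => [|N IH].
    rewrite big_geq // /S.
    have [K1|K1] := leqP K 1.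
      rewrite big1 // => -[k kK] /= /andP[k0 _]; move: (leq_trans kK K1); lia.
    rewrite (big_pred1 (Ordinal K1)) ?t1 // => k; rewrite /= -val_eqE /=.
    apply/andP/eqP => [[k0 /allP a]|->//]; have [k1|k1|//] := ltngtP (val k) 1%N.
      by rewrite ltnNge k0 in k1.
    by have := a (pdiv k); rewrite mem_primes pdiv_prime // k0 pdiv_dvd => /(_ isT).
  rewrite big_mkcond big_nat_recr //= -big_mkcond /=.
  case: ifP => pN; last first.
    rewrite mulr1; apply: le_trans IH; rewrite /S le_eqVlt; apply/orP; left.
    apply/eqP/eq_bigl => k; congr andb; apply: eq_in_all => p.
    rewrite mem_primes => /andP[pp _]; rewrite ltnS leq_eqVlt.
    by case: eqP pp => //= ->; rewrite pN.
  rewrite ler_pdivlMr ?subr_gt0 ?tlt // mulrBr mulr1 lerBlDr.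
  apply: le_trans (_ : S N + S N.+1 * t N <= _); last by rewrite lerD2r.
  rewrite {1}/S (bigID (fun k : 'I_K => (N %| k)%N)) /= addrC lerD //.
    rewrite /S le_eqVlt; apply/orP; left; apply/eqP/eq_bigl => k.
    case k0: (0 < k)%N => //=; apply/andP/allP => [[/allP a Nk] p pk|a].
      have := a _ pk; rewrite ltnS leq_eqVlt => /orP[/eqP e|//].
      by move: pk; rewrite e mem_primes (negPf Nk) !andbF.
    split; first by apply/allP=> p /a; exact: ltnW.
    by apply/negP => Nk; have := a N; rewrite mem_primes pN k0 Nk ltnn; move/(_ isT).
  rewrite /S mulr_suml.
  have KP (k : 'I_K) : (k %/ N < K)%N by apply: leq_ltn_trans (leq_div _ _) (ltn_ord k).
  apply: (ler_sum_inj (h := fun k => Ordinal (KP k))).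
  - move=> i j /andP[_ Ni] /andP[_ Nj] [e]; apply/val_inj.
    by rewrite /= -(divnK Ni) e divnK.
  - move=> k /andP[/andP[k0 /allP a] Nk] /=; rewrite divn_gt0 ?prime_gt0 // dvdn_leq //=.
    by apply/allP=> p; rewrite mem_primes => /and3P[pp _ pk]; apply: a;
       rewrite mem_primes pp k0 /= -(divnK Nk) dvdn_mulr.
  - by move=> k _; rewrite mulr_ge0.
  - by move=> k /andP[_ Nk] /=; rewrite -tM divnK.
apply: le_trans (SN K); rewrite /S {SN S}.
rewrite -(big_mkord (fun k => (0 < k)%N && all (fun p => (p < K)%N) (primes k))).
rewrite big_mkcond [leRHS]big_mkcond /=.
case: K => [|K]; first by rewrite !big_geq.
rewrite [leRHS]big_nat_recl //= add0r big_add1 /= !big_nat le_eqVlt; apply/orP; left.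
apply/eqP/eq_bigr => k /andP[_ kK].
rewrite ifT //; apply/allP => p; rewrite mem_primes => /and3P[_ _ /dvdn_leq].
by move=> /(_ isT) /leq_ltn_trans; apply.
Qed.

(** * Upper bound for the Euler product of the root counts *)

Definition nroots (f : {poly int}) (p : nat) : nat :=
  (\sum_(r < p) (p %| absz f.[r%:Z])%N)%N.

Lemma companion_exists (R : comNzRingType) (f : {poly R}) n :
  f \is monic -> size f = n.+2 -> exists C : 'M[R]_n.+1, char_poly C = f.
Proof.
move=> mf sf; have := companionmxK mf; move: (companionmx f); rewrite sf => C <-.
by exists C.
Qed.

(** Expanding the product chooses at each [p] either 1 or one of the roots modulo [p]; the invalid
    choices carry weight 0. *)
Lemma prod_roots_selections (R : realType) (s : R) (f : {poly int}) N :
  \prod_(0 <= p < N | prime p) (1 + (nroots f p)%:R * wt s p) =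
  \sum_(g : root_selection N | valid_selection f g) wt s (selection_modulus g).
Proof.
pose F (p : 'I_N) (o : option 'I_N) : R := if o is Some r then
  (if [&& prime p, (r < p)%N & (p %| absz f.[r%:Z])%N] then wt s p else 0) else 1.
have -> : \prod_(0 <= p < N | prime p) (1 + (nroots f p)%:R * wt s p) =
    \prod_(p < N) \sum_o F p o.
  rewrite big_mkcond big_mkord; apply: eq_bigr => p _.
  rewrite (bigD1 None) //= (reindex_omap Some id) /=; last by case.
  rewrite (eq_bigl predT); last by move=> r; rewrite /= eqxx.
  case: ifP => pp /=; last by rewrite big1 ?addr0 // => r _; rewrite pp.
  congr (_ + _).
  rewrite /nroots (big_ord_widen_cond _ xpredT (fun r : nat => nat_of_bool (p %| absz f.[r%:Z])%N)
    (ltnW (ltn_ord p))).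
  rewrite natr_sum mulr_suml big_mkcond /=; apply: eq_bigr => r _.
  by case: ltnP => //= _; case: ifP; rewrite ?mul1r ?mul0r.
rewrite bigA_distr_bigA [LHS](bigID (@valid_selection f N)) /= [X in _ + X]big1 ?addr0.
  apply: eq_bigr => g vg; rewrite wt_prod [RHS]big_mkcond /=; apply: eq_bigr => p _.
  rewrite /F; case Ep: (g p) => [r|] //=.
  by have [-> -> ->] := valid_selectionP vg Ep.
move=> g; rewrite negb_forall => /existsP[p]; case Ep: (g p) => [r|] // nv.
by rewrite (bigD1 p) //= /F Ep (negPf nv) mul0r.
Qed.

(** Selections of height [k] have modulus at least [k ^ n.+1] and number at most [K * k ^ n], so the
    expanded product is at most [K] times the sum of the [wt (1 + e) k], hence at most
    [K * (1 + 1/e)]. *)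
Theorem prod_roots_bound (R : realType) (f : {poly int}) n :
  f \is monic -> size f = n.+2 -> irreducible_over_rat f ->
  exists2 A : R, 0 < A & forall (e : R) N, 0 < e -> e <= 1 ->
    \prod_(0 <= p < N | prime p) (1 + (nroots f p)%:R * wt (1 + e) p) <= A / e.
Proof.
move=> mf /(companion_exists mf)[C <-] irr {f mf}.
have [K K0 HK] := selections_by_height irr.
exists (2 * K%:R); first by rewrite mulr_gt0 ?ltr0n.
move=> e N e0 e1; rewrite prod_roots_selections; have [h [hg hk]] := HK N.
have s0 : 0 <= 1 + e by rewrite addr_ge0 // ltW.
apply: (@le_trans _ _ (\sum_(g | valid_selection (char_poly C) g) wt (1 + e) (h g) ^+ n.+1)).
  apply: ler_sum => g vg; rewrite -wtX; have [h0 hm] := hg g vg.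
  by apply: wt_le; rewrite ?expn_gt0 ?h0.
pose H := \max_g h g.
have Hh g : (h g < H.+1)%N by rewrite ltnS leq_bigmax.
rewrite (partition_big (fun g => Ordinal (Hh g)) xpredT) //=.
apply: (@le_trans _ _ (K%:R * \sum_(1 <= k < H.+1) wt (1 + e) k)).
  rewrite mulr_sumr big_add1 /= big_mkord big_ord_recl /=.
  rewrite [X in X + _]big1 ?add0r; last first.
    by move=> g /andP[vg /eqP/(congr1 val) /= h0]; have [] := hg g vg; rewrite h0.
  apply: ler_sum => k _.
  rewrite (eq_bigr (fun=> wt (1 + e) k.+1 ^+ n.+1)); last first.
    by move=> g /andP[_ /eqP/(congr1 val) /= ->].
  rewrite sumr_const exprS -[leLHS]mulr_natl mulrCA.
  have w0 := wt_ge0 (1 + e) k.+1; have k0 : 0 < k.+1%:R :> R by rewrite ltr0n.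
  rewrite [leRHS]mulrC ler_wpM2l //.
  apply: (@le_trans _ _ ((K * k.+1 ^ n)%:R * wt (1 + e) k.+1 ^+ n)).
    rewrite ler_wpM2r ?exprn_ge0 // ler_nat; apply: leq_trans (hk k.+1 isT).
    apply/eq_leq/eq_card => g; by rewrite !inE.
  rewrite natrM natrX -mulrA -exprMn ler_piMr ?ler0n // exprn_ile1 ?mulr_ge0 //.
  by rewrite mulrC -ler_pdivlMr // mul1r wt1D_le // ltW.
rewrite -mulrA mulrCA ler_wpM2l // ?ler0n //.
apply: le_trans (sum_wt_le _ e0) _; rewrite -[2]/(1 + 1) mulrDl mul1r lerD2r.
by rewrite invf_ge1.
Qed.

(** * The sieve *)

Definition box_vector d X (x : {ffun 'I_d -> 'I_X}) : 'rV[int]_d := \row_i (x i : nat)%:Z.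

Lemma box_vector_inj d X : injective (@box_vector d X).
Proof.
move=> x y /rowP e; apply/ffunP => i; apply/val_inj.
by have := e i; rewrite !mxE => -[].
Qed.

Lemma box_vector_norm d X (x : {ffun 'I_d -> 'I_X}) i : `|box_vector x 0 i| <= X%:Z.
Proof. by rewrite mxE /= ger0_norm // lez_nat ltnW. Qed.

(* A nonzero difference of two lattice points has norm at least [m], so each
   subcube of side [Y], where [c * Y ^ n.+1 < m], contains at most one of them. *)
Lemma card_box_lattice n (C : 'M[int]_n.+1) (c m X : nat) (L : pred 'rV[int]_n.+1) :
  irreducible_over_rat (char_poly C) ->
  (forall (a : 'rV[int]_n.+1) (h : nat), (forall i, `|a 0 i| <= h%:Z) ->
     (absz (norm_form C a) <= c * h ^ n.+1)%N) ->
  (forall a b, L a -> L b -> L (a - b)) ->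
  (forall a, L a -> (m %| absz (norm_form C a))%N) ->
  (c < m)%N ->
  (#|[set x : {ffun 'I_n.+1 -> 'I_X} | (box_vector x != 0%R) && L (box_vector x)]| * m <=
     4 ^ n.+1 * c * X ^ n.+1)%N.
Proof.
move=> irr Hc LB Lm cm; set S := [set x | _].
have small a : L a -> (absz (norm_form C a) < m)%N -> a = 0.
  move=> La; apply: contraTeq => a0; rewrite -leqNgt dvdn_leq ?Lm //.
  by rewrite absz_gt0 norm_form_neq0.
have [->|[x0]] := set_0Vmem S; first by rewrite cards0.
rewrite inE => /andP[x00 Lx0].
(* A nonzero lattice point in the box forces the box to be this large; this gives [Y < X] below. *)
have mX : (m <= c * X ^ n.+1)%N.
  rewrite leqNgt; apply: contra x00 => lt; apply/eqP/small => //.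
  by apply: leq_ltn_trans lt; apply: Hc => i; apply: box_vector_norm.
have c0 : (0 < c)%N by case: (c) mX => //; lia.
have exY : exists Y, (c * Y ^ n.+1 < m)%N by exists 1%N; rewrite exp1n muln1.
have ubY Y : (c * Y ^ n.+1 < m)%N -> (Y <= m)%N.
  move=> h; apply: leq_trans (ltnW h); apply: leq_trans (leq_pmull _ c0).
  by case: (Y) => // k; rewrite -{1}[k.+1]expn1 leq_pexp2l.
have [Y Ym Ymax] := ex_maxnP exY ubY.
have Y1 : (1 <= Y)%N by apply: Ymax; rewrite exp1n muln1.
have YX : (Y < X)%N.
  rewrite -(@ltn_exp2r _ _ n.+1) // -(ltn_pmul2l c0); exact: leq_trans mX.
(* Maximality of [Y] keeps the cells large, so that their number times [m] stays of order
   [X ^ n.+1]. *)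
have mY : (m <= c * (2 * Y) ^ n.+1)%N.
  apply: (@leq_trans (c * Y.+1 ^ n.+1)%N).
    by rewrite leqNgt; apply/negP => /Ymax; rewrite ltnn.
  rewrite leq_mul2l leq_exp2r // (_ : (Y < 2 * Y)%N) ?orbT //; lia.
have H (x : {ffun 'I_n.+1 -> 'I_X}) i : (x i %/ Y < (X %/ Y).+1)%N.
  by rewrite ltnS leq_div2r // ltnW.
pose cell x := [ffun i => Ordinal (H x i)].
have cS : (#|S| <= (X %/ Y).+1 ^ n.+1)%N.
  rewrite -(@card_in_imset _ _ cell).
    by apply: leq_trans (max_card _) _; rewrite card_ffun !card_ord.
  move=> x y; rewrite !inE => /andP[_ Lx] /andP[_ Ly] /ffunP e.
  apply/box_vector_inj/eqP; rewrite -subr_eq0; apply/eqP/small; first exact: LB.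
  apply: leq_ltn_trans Ym; apply: Hc => i; rewrite !mxE.
  have := e i; rewrite !ffunE => /(congr1 val) /= ei.
  have := divn_eq (x i) Y; have := divn_eq (y i) Y; rewrite ei.
  have := ltn_pmod (x i) Y1; have := ltn_pmod (y i) Y1; lia.
apply: (@leq_trans ((X %/ Y).+1 ^ n.+1 * (c * (2 * Y) ^ n.+1))); first exact: leq_mul.
have -> : ((X %/ Y).+1 ^ n.+1 * (c * (2 * Y) ^ n.+1) = c * (2 * ((X %/ Y).+1 * Y)) ^ n.+1)%N.
  rewrite !expnMn; ring.
rewrite [X in (_ <= X)%N]mulnAC [X in (_ <= X)%N]mulnC leq_mul2l -expnMn leq_exp2r //.
rewrite (_ : 4 = 2 * 2)%N // -mulnA leq_mul2l mulSn.
have := leq_trunc_div X Y; lia.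
Qed.

Lemma Frobenius_root (E : fieldType) p (g : {poly int}) (x : E) : p \in [pchar E] ->
  root (map_poly intr g) x -> root (map_poly intr g) (x ^+ p).
Proof.
move=> pE; rewrite /root -(pFrobenius_autE pE) => /eqP gx.
have -> : map_poly intr g = map_poly (pFrobenius_aut pE) (map_poly intr g) :> {poly E}.
  by rewrite -map_poly_comp; apply: eq_map_poly => z /=; rewrite rmorph_int.
by rewrite horner_map /= gx rmorph0.
Qed.

Lemma root_in_prime_field p (E : fieldType) (phi : {rmorphism 'F_p -> E}) (x : E) :
  prime p -> x ^+ p = x -> exists y, x = phi y.
Proof.
move=> pp xp; have := finField_genPoly 'F_p => /(congr1 (map_poly phi)).
rewrite rmorph_prod rmorphB /= map_polyXn map_polyX card_Fp // => e.
have : root ('X^p - 'X) x by rewrite /root !hornerE xp subrr.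
rewrite e -big_enum /=.
under eq_bigr do rewrite rmorphB /= map_polyX map_polyC.
rewrite -(big_map phi xpredT (fun z => 'X - z%:P)) root_prod_XsubC => /mapP[y _ ->].
by exists y.
Qed.

Lemma nroots_gt0 (f : {poly int}) p (y : 'F_p) : prime p ->
  root (map_poly intr f) y -> (0 < nroots f p)%N.
Proof.
move=> pp ry; have yp : (y < p)%N by rewrite -[X in (_ < X)%N](Fp_cast pp).
rewrite /nroots (bigD1 (Ordinal yp)) //=.
suff -> : (p %| absz f.[(y : nat)%:Z])%N by [].
rewrite -intr_Fp_eq0 // -horner_map /= -pmulrn.
by rewrite -[X in _.[X]]/(y%:R) natr_Zp.
Qed.

(* A common root of [a] and [f] outside the prime field comes with its Frobenius conjugate,
   so [p ^ 2] divides the norm; hence the weaker bound when [f] has no root modulo [p]. *)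
Lemma card_box_prime n (C : 'M[int]_n.+1) :
  irreducible_over_rat (char_poly C) ->
  exists2 c : nat, (0 < c)%N & forall p X, prime p -> (c < p)%N ->
  (#|[set x : {ffun 'I_n.+1 -> 'I_X} | (box_vector x != 0%R) &&
        (p %| absz (norm_form C (box_vector x)))]| *
     (if (0 < nroots (char_poly C) p) then p else p ^ 2) <= c * X ^ n.+1)%N.
Proof.
move=> irr; have [c c0 Hc] := norm_form_bound C.
(* The lattice bound is summed over the [n.+1] roots of the characteristic polynomial in an
   algebraic closure of ['F_p], listed with multiplicity. *)
exists (n.+1 * (4 ^ n.+1 * c))%N; first by rewrite !muln_gt0 expn_gt0 c0.
move=> p X pp cp; have {}cp : (c < p)%N.
  apply: leq_ltn_trans cp; rewrite mulnA leq_pmull // muln_gt0 expn_gt0 //.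
have [E [phi _]] := countable_algebraic_closure 'F_p.
have pE : p \in [pchar E] by rewrite (rmorph_pchar phi) // pchar_Fp.
set f := char_poly C; set w := if _ then _ else _.
pose fE : {poly E} := map_poly intr f.
have szf : size fE = n.+2.
  by rewrite size_map_poly_id0 ?size_char_poly // (monicP (char_poly_monic C)) rmorph1 oner_neq0.
have [rs Drs] := closed_field_poly_normal fE.
have lead : lead_coef fE = 1.
  by apply/eqP; rewrite -[_ == 1]/(fE \is monic) monic_map // char_poly_monic.
rewrite lead scale1r in Drs.
have srs : size rs = n.+1 by apply/eqP; rewrite -eqSS -(size_prod_XsubC rs id) -Drs szf.
pose La (rho : E) : pred 'rV[int]_n.+1 := fun a => common_root C a rho.
pose S rho := [set x : {ffun 'I_n.+1 -> 'I_X} | (box_vector x != 0) && La rho (box_vector x)].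
have cardS rho : root fE rho -> (#|S rho| * w <= 4 ^ n.+1 * c * X ^ n.+1)%N.
  move=> rf; apply: (@card_box_lattice n C c w X (La rho) irr Hc).
  - move=> a b /andP[_ ra] /andP[_ rb]; rewrite /La /common_root rf /=.
    by rewrite raddfB /= rmorphB rootE !hornerE (eqP ra) (eqP rb) subrr.
  - move=> a ra; rewrite /w; case: ifP => [_|nr]; first exact: (common_root_dvd_norm phi pp ra).
    apply: (common_roots_dvd_norm phi pp (rho1 := rho) (rho2 := rho ^+ p)) => //.
      apply/eqP => e; have [y Ey] := root_in_prime_field phi pp (esym e).
      suff : (0 < nroots f p)%N by rewrite nr.
      apply: (nroots_gt0 (y := y)) => //.
      rewrite -(fmorph_root phi) -Ey -map_poly_comp.
      by rewrite (eq_map_poly (g := intr)) // => z /=; rewrite rmorph_int.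
    by case/andP: ra => r1 r2; rewrite /common_root !Frobenius_root.
  - rewrite /w; case: ifP => // _; apply: (leq_trans cp); rewrite leq_pmulr ?prime_gt0 //.
have : (#|[set x : {ffun 'I_n.+1 -> 'I_X} | (box_vector x != 0%R) &&
        (p %| absz (norm_form C (box_vector x)))]| <= \sum_(rho <- rs) #|S rho|)%N.
  under eq_bigr do rewrite -sum1dep_card big_mkcond.
  rewrite exchange_big /= -sum1dep_card big_mkcond; apply: leq_sum => x _.
  case: ifP => // /andP[x0 px]; have [rho cr] := norm_dvd_common_root phi pp px.
  have : rho \in rs by case/andP: cr; rewrite -[map_poly _ _]/fE Drs root_prod_XsubC.
  by move=> rrs; rewrite (big_rem rho) //= x0 /La cr.
rewrite -(@leq_pmul2r w); last by rewrite /w; case: ifP => _; rewrite ?expn_gt0 prime_gt0.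
move/leq_trans; apply; rewrite big_distrl /= big_seq.
apply: (@leq_trans (\sum_(rho <- rs | rho \in rs) 4 ^ n.+1 * c * X ^ n.+1)).
  by apply: leq_sum => rho rrs; apply: cardS; rewrite Drs root_prod_XsubC.
by rewrite -big_seq big_const_seq count_predT iter_addn addn0 srs mulnC !mulnA.
Qed.

Lemma leq_card_fibers (T K : finType) (A : {pred T}) (key : T -> K) m :
  (forall k, (#|[pred x in A | key x == k]| <= m)%N) -> (#|A| <= m * #|K|)%N.
Proof.
move=> fib; rewrite -sum1_card (partition_big key xpredT) //=.
rewrite mulnC -sum_nat_const; apply: leq_sum => k _.
by rewrite sum1_card; apply: leq_trans (fib k).
Qed.

(** With the other coordinates fixed, the norm is a monic polynomial of degree [n.+1] in coordinate
    0, namely the characteristic polynomial of the negated matrix of [a'], so it takes the value [v]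
    at most [n.+1] times. *)
Lemma card_norm_fiber n (C : 'M[int]_n.+1) X (v : int) (x0 : {ffun 'I_n.+1 -> 'I_X}) :
  (#|[set x : {ffun 'I_n.+1 -> 'I_X} | (norm_form C (box_vector x) == v) &&
     [forall j, x (lift ord0 j) == x0 (lift ord0 j)]]| <= n.+1)%N.
Proof.
set F := [set x | _].
pose a' : 'rV[int]_n.+1 := \row_i (if i == 0 then 0 else (x0 i : nat)%:Z).
pose g := char_poly (- horner_mx C (rVpoly a')) - v%:P.
have sg : size g = n.+2.
  by rewrite size_polyDl size_char_poly // size_polyN (leq_ltn_trans (size_polyC_leq1 _)).
have g0 : g != 0 by rewrite -size_poly_gt0 sg.
have rootF x : x \in F -> root g (x ord0 : nat)%:Z.
  rewrite inE => /andP[/eqP Nx /forallP xx0].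
  rewrite rootE !hornerE subr_eq0 -Nx /norm_form /char_poly.
  rewrite -[_.[_]]/(horner_eval _ _) -det_map_mx; apply/eqP; congr (\det _).
  have -> : rVpoly (box_vector x) = (x ord0 : nat)%:Z%:P + rVpoly a'.
    apply/polyP=> i; rewrite coefD coefC !coef_rVpoly.
    case: insubP => [j _ <-|]; rewrite ?mxE.
      case: (unliftP 0 j) => [k ->|->]; last by rewrite eqxx addr0.
      by rewrite (eqP (xx0 k)) /= add0r.
    by case: i => //; rewrite addr0.
  rewrite (rmorphD (horner_mx C)) /= horner_mx_C; apply/matrixP=> i j; rewrite !mxE /horner_eval.
  by rewrite !hornerE; case: (i == j); rewrite ?mulr1n ?mulr0n !hornerE ?opprK.
rewrite cardE -(size_map (fun x : {ffun 'I_n.+1 -> 'I_X} => (x ord0 : nat)%:Z)) -ltnS -sg.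
apply: max_poly_roots => //.
  by apply/allP => _ /mapP[x xF ->]; apply: rootF; rewrite -mem_enum.
rewrite map_inj_in_uniq ?enum_uniq // => x y; rewrite !mem_enum !inE.
move=> /andP[_ /forallP xx] /andP[_ /forallP yy] [e]; apply/ffunP => i.
case: (unliftP ord0 i) => [j|] ->; last exact: val_inj.
by rewrite (eqP (xx j)) (eqP (yy j)).
Qed.

Definition smooth (y v : nat) : bool := all (fun p => (p < y)%N) (primes v).

(** A nonzero smooth norm is determined by its sign and its exponents, at most [L], at the primes
    below [y]. The key records these and the coordinates other than the first. *)
Lemma card_box_smooth n (C : 'M[int]_n.+1) X y L :
  irreducible_over_rat (char_poly C) ->
  (forall x : {ffun 'I_n.+1 -> 'I_X}, (absz (norm_form C (box_vector x)) <= 2 ^ L)%N) ->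
  (#|[set x : {ffun 'I_n.+1 -> 'I_X} | (box_vector x != 0%R) &&
      smooth y (absz (norm_form C (box_vector x)))]| <= n.+1 * (2 * L.+1 ^ y * X ^ n))%N.
Proof.
move=> irr HL; pose N (x : {ffun 'I_n.+1 -> 'I_X}) := norm_form C (box_vector x).
pose key x := ((N x < 0)%R, [ffun p : 'I_y => inord (logn p (absz (N x))) : 'I_L.+1],
   [ffun j : 'I_n => x (lift ord0 j)]).
set A := [set x | _].
have := @leq_card_fibers _ _ [in A] key n.+1.
rewrite !card_prod !card_ffun !card_ord card_bool; apply=> k.
have [x0 /= x0F|F0] := pickP [pred x in A | key x == k]; last by rewrite eq_card0.
apply: leq_trans (card_norm_fiber C (N x0) x0); apply/subset_leq_card/subsetP => x.
move: x0F; rewrite !inE => /andP[/andP[n0 s0] /eqP<-].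
move=> /andP[/andP[nx sx] /eqP[es /ffunP el /ffunP er]].
apply/andP; split; last first.
  by apply/forallP=> j; have := er j; rewrite !ffunE => ->.
suff e : absz (N x) = absz (N x0) by move: es e; rewrite -/(N x); lia.
have pos z : box_vector z != 0 -> (0 < absz (N z))%N.
  by move=> z0; rewrite absz_gt0 norm_form_neq0.
apply: eqn_from_log; [exact: pos..|] => p.
have log0 z : ~~ (p < y)%N -> smooth y (absz (N z)) -> logn p (absz (N z)) = 0%N.
  move=> py /allP sz; rewrite lognE; case: ifP => // /and3P[pp z0 dz].
  by move: py; rewrite sz // mem_primes pp z0.
have [py|py] := boolP (p < y)%N; last by rewrite !log0.
have := el (Ordinal py); rewrite !ffunE /= => /(congr1 val) /=.
have lt z : box_vector z != 0 -> (logn p (absz (N z)) < L.+1)%N.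
  move=> z0; rewrite ltnS -(@leq_exp2l 2) //; apply: leq_trans (HL z).
  have [pp|np] := boolP (prime p); last by rewrite lognE (negPf np) expn0 pos.
  apply: (@leq_trans (p ^ logn p (absz (N z)))); last by rewrite dvdn_leq ?pos // pfactor_dvdnn.
  by case: (logn _ _) => // l; rewrite leq_exp2r // prime_gt1.
by rewrite !inordK ?lt.
Qed.

(** * Divergence over the primes with a root *)

Section PrimeSums.

Variable R : archiRealFieldType.

Lemma sum_inv_squares_le y N : (1 < y)%N ->
  \sum_(y <= k < N) (k%:R ^- 2 : R) <= (y.-1%:R)^-1.
Proof.
move=> y1; have [Ny|yN] := leqP N y.
  by rewrite big_geq // invr_ge0 ler0n.
apply: (@le_trans _ _ (\sum_(y <= k < N) (- (k.+1.-1%:R)^-1 - - (k.-1%:R)^-1))).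
  rewrite !big_nat; apply: ler_sum => -[|[|k]] /andP[yk _] /=; [lia|lia|].
  have k1 : 0 < k.+1%:R :> R by rewrite ltr0n.
  have k2 : 0 < k.+2%:R :> R by rewrite ltr0n.
  have -> : - k.+2%:R^-1 - - k.+1%:R^-1 = (k.+2%:R * k.+1%:R)^-1 :> R.
    move: k1 k2; rewrite -[k.+2%:R]natr1; move: (k.+1%:R : R) => a a0 a1.
    by field; rewrite !lt0r_neq0.
  by rewrite lef_pV2 ?posrE ?exprn_gt0 ?mulr_gt0 // expr2 ler_pM2l // ler_nat.
rewrite (telescope_sumr (fun k => - (k.-1%:R)^-1)) ?(ltnW yN) //.
by rewrite opprK addrC gerDl oppr_le0 invr_ge0 ler0n.
Qed.

(** Otherwise [u] would gain more than [e] again and again, and pass [M]. *)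
Lemma tail_le (u : nat -> R) (M e : R) y1 : (forall N, u N <= M) -> 0 < e ->
  {homo u : a b / (a <= b)%N >-> a <= b} ->
  exists2 y, (y1 <= y)%N & forall N, u N - u y <= e.
Proof.
move=> uM e0 mono; apply: contrapT => H.
have step j : exists2 N, (y1 <= N)%N & u y1 + e *+ j <= u N.
  elim: j => [|j [N yN uN]]; first by exists y1; rewrite ?mulr0n ?addr0.
  have [N' hN'] : exists N', e < u N' - u N.
    apply: contrapT => /forallNP H'; apply: H; exists N => // N'.
    by rewrite leNgt; apply/negP/H'.
  exists N'; last by rewrite mulrSr addrA; lra.
  apply: leq_trans yN _; rewrite leqNgt; apply/negP => /ltnW/mono; lra.
pose j := Num.bound ((M - u y1) / e).
have [N _ /le_trans/(_ (uM N))] := step j.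
rewrite -lerBrDl -mulr_natr -ler_pdivlMl // mulrC leNgt => /negP; apply.
apply: archi_boundP; rewrite divr_ge0 ?(ltW e0) // subr_ge0; exact: uM.
Qed.

End PrimeSums.

Lemma exp_gt_poly A B k : exists e : nat, (A + B * e.+1 ^ k < 2 ^ e)%N.
Proof.
(* With [e.+1] a power of 2, the polynomial is bounded by a power of 2 and only exponents remain to
   be compared. *)
pose i := (A + B + 2 * k + 1)%N; exists (2 ^ (2 * i)).-1; rewrite prednK ?expn_gt0 // -expnM.
apply: (@leq_ltn_trans ((A + B) * 2 ^ (2 * i * k))).
  by rewrite mulnDl leq_add2r leq_pmulr // expn_gt0.
apply: (@leq_trans (2 ^ (A + B + 2 * i * k))).
  by rewrite expnD ltn_pmul2r ?expn_gt0 // ltn_expl.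
rewrite leq_exp2l // -ltnS prednK ?expn_gt0 // mul2n -addnn expnD.
have h : (i.+1 <= 2 ^ i)%N by rewrite ltn_expl.
apply: (@leq_trans (i.+1 * i.+1)); last exact: leq_mul.
by rewrite /i; nia.
Qed.

Theorem split_primes_diverge (R : realType) (f : {poly int}) n y0 (M : R) :
  f \is monic -> size f = n.+2 -> irreducible_over_rat f ->
  exists N, M < \sum_(y0 <= p < N | prime p && (0 < nroots f p)%N) p%:R^-1.
Proof.
move=> mf /(companion_exists mf)[C <-] irr {f mf}; set f := char_poly C.
apply: contrapT => /forallNP bounded.
have [c c0 Hc] := norm_form_bound C.
have [K K0 HK] := card_box_prime irr.
pose sp p := prime p && (0 < nroots f p)%N.
pose u N : R := \sum_(y0 <= p < N | sp p) p%:R^-1.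
have uM N : u N <= M by rewrite leNgt; apply/negP; apply: bounded.
have u_cat a b : (y0 <= a)%N -> (a <= b)%N -> u b = u a + \sum_(a <= p < b | sp p) p%:R^-1.
  by move=> ya ab; rewrite /u (big_cat_nat (n := a)).
have s0 a b : 0 <= \sum_(a <= p < b | sp p) p%:R^-1 :> R.
  by apply: sumr_ge0 => p _; rewrite invr_ge0 ler0n.
have mono : {homo u : a b / (a <= b)%N >-> a <= b}.
  move=> a b ab; have [ya|ay] := leqP y0 a; first by rewrite (u_cat a b) // lerDl.
  by rewrite {1}/u big_geq ?(ltnW ay) //; apply: s0.
(* The primes with a root and the squares [p ^- 2] each get a tail of at most [1 / (4 * K)], so that
   the vectors with a norm divisible by a prime from [y] on fill at most half of the cube. *)
have e0 : 0 < (4 * K%:R)^-1 :> R by rewrite invr_gt0 mulr_gt0 ?ltr0n.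
have [y yy Hy] := tail_le (maxn y0 (maxn K.+1 (4 * K).+1)) uM e0 mono.
have [y0y Ky K4y] : [/\ y0 <= y, K < y & 4 * K < y]%N by move: yy; rewrite !geq_max => /and3P[].
(* The cube has side [2 ^ e]. The smooth vectors number [O(L ^ y * X ^ n)] with [L] linear in [e];
   this choice of [e] makes them and the zero vector fewer than half of the cube. *)
have [e He] := exp_gt_poly 2 (4 * n.+1 * (c + n.+1).+1 ^ y) y.
pose L := (c + e * n.+1)%N; pose X := (2 ^ e)%N.
have HL (x : {ffun 'I_n.+1 -> 'I_X}) : (absz (norm_form C (box_vector x)) <= 2 ^ L)%N.
  apply: leq_trans (Hc _ X _) _; first exact: box_vector_norm.
  by rewrite /X -expnM /L expnD leq_mul2r ltnW ?orbT // ltn_expl.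
pose N (x : {ffun 'I_n.+1 -> 'I_X}) := absz (norm_form C (box_vector x)).
pose V p := [set x : {ffun 'I_n.+1 -> 'I_X} | (box_vector x != 0) && (p %| N x)%N].
(* The summand 1 is the zero vector; a nonzero norm that is not smooth has a prime factor from [y]
   on, and its size limits that factor to [2 ^ L]. *)
have card_cover : (X ^ n.+1 <= 1 + n.+1 * (2 * L.+1 ^ y * X ^ n) +
    \sum_(y <= p < (2 ^ L).+1 | prime p) #|V p|)%N.
  pose Z := [set x : {ffun 'I_n.+1 -> 'I_X} | box_vector x == 0].
  pose A := [set x : {ffun 'I_n.+1 -> 'I_X} | (box_vector x != 0%R) && smooth y (N x)].
  have cZ : (#|Z| <= 1)%N.
    apply/card_le1_eqP => x x'; rewrite !inE => /eqP zx /eqP zx'.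
    by apply: box_vector_inj; rewrite zx zx'.
  have cA := card_box_smooth y irr HL.
  apply: (@leq_trans (#|Z| + #|A| + \sum_(y <= p < (2 ^ L).+1 | prime p) #|V p|)).
    have -> : (X ^ n.+1 = \sum_(x : {ffun 'I_n.+1 -> 'I_X}) 1)%N.
      by rewrite sum1_card card_ffun !card_ord.
    have cs (S : {set {ffun 'I_n.+1 -> 'I_X}}) : #|S| = (\sum_x (x \in S))%N.
      by rewrite -sum1_card big_mkcond; apply: eq_bigr => x _; case: (x \in S).
    under [X in (_ <= _ + X)%N]eq_bigr do rewrite cs.
    rewrite (cs Z) (cs A) exchange_big /= -!big_split /=.
    apply: leq_sum => x _; rewrite !inE; case: eqP => //= x0.
    case: (boolP (smooth _ _)) => //= /allPn[p]; rewrite mem_primes => /and3P[pp N0 pN] py.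
    rewrite add0n (big_rem p) /=; first by rewrite pp !inE pN; case: eqP.
    rewrite mem_index_iota leqNgt py ltnS (leq_trans _ (HL x)) // dvdn_leq //.
  by rewrite leq_add2r leq_add.
have HV p : prime p -> (y <= p)%N -> (#|V p|)%:R <=
    K%:R * (X ^ n.+1)%:R * ((if sp p then p%:R^-1 else 0) + p%:R ^- 2) :> R.
  move=> pp yp; have p0 : 0 < p%:R :> R by rewrite ltr0n prime_gt0.
  have := HK p X pp (leq_trans Ky yp); rewrite /sp pp /= -/f -/(V p) -(ler_nat R) !natrM.
  have KX : 0 <= K%:R * (X ^ n.+1)%:R :> R by rewrite mulr_ge0 ?ler0n.
  case: ifP => _; last by rewrite add0r natrX -ler_pdivlMr ?exprn_gt0.
  rewrite -ler_pdivlMr // => /le_trans; apply; rewrite ler_wpM2l // lerDl.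
  by rewrite invr_ge0 exprn_ge0 // ltW.
have tail1 : \sum_(y <= p < (2 ^ L).+1 | sp p) p%:R^-1 <= (4 * K%:R)^-1 :> R.
  have [lt|le] := leqP y (2 ^ L).+1; last by rewrite big_geq ?(ltnW le) // ltW.
  by have := Hy (2 ^ L).+1; rewrite (u_cat y) // addrC addKr.
have tail2 : \sum_(y <= p < (2 ^ L).+1) (p%:R ^- 2) <= (4 * K%:R)^-1 :> R.
  apply: le_trans (sum_inv_squares_le _ _ _) _; first lia.
  rewrite lef_pV2 ?posrE ?mulr_gt0 ?ltr0n //; [rewrite -natrM ler_nat; lia | lia].
have X0 : 0 < (X ^ n.+1)%:R :> R by rewrite ltr0n !expn_gt0.
have half : (\sum_(y <= p < (2 ^ L).+1 | prime p) #|V p|)%N%:R <= (X ^ n.+1)%:R / 2 :> R.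
  rewrite natr_sum.
  apply: (@le_trans _ _ (\sum_(y <= p < (2 ^ L).+1) K%:R * (X ^ n.+1)%:R *
      ((if sp p then p%:R^-1 else 0) + p%:R ^- 2))).
    rewrite big_mkcond !big_nat; apply: ler_sum => p /andP[yp _].
    case: ifP => [pp|_]; first exact: HV.
    rewrite !mulr_ge0 ?ler0n // addr_ge0 ?invr_ge0 ?exprn_ge0 ?ler0n //.
    by case: ifP; rewrite ?invr_ge0 ?ler0n.
  rewrite -mulr_sumr big_split /= -big_mkcond /=.
  apply: (@le_trans _ _ (K%:R * (X ^ n.+1)%:R * ((4 * K%:R)^-1 + (4 * K%:R)^-1))).
    by rewrite ler_wpM2l ?mulr_ge0 ?ler0n // lerD.
  rewrite le_eqVlt; apply/orP; left; apply/eqP; field; rewrite pnatr_eq0; lia.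
have : (X ^ n.+1 <= 2 * (1 + n.+1 * (2 * L.+1 ^ y * X ^ n)))%N.
  move: card_cover; rewrite -!(ler_nat R) natrD; move: half.
  set q := _%:R; set w := (1 + _)%N => h1 h2.
  rewrite natrM; lra.
rewrite leqNgt => /negP; apply.
rewrite expnS; apply: (@leq_ltn_trans ((2 + 4 * n.+1 * (c + n.+1).+1 ^ y * e.+1 ^ y) * X ^ n)).
  have X1 : (1 <= X ^ n)%N by rewrite !expn_gt0.
  have LL : (L.+1 ^ y <= (c + n.+1).+1 ^ y * e.+1 ^ y)%N.
    rewrite -expnMn leq_exp2r; [rewrite /L; nia | lia].
  set q := (_ * e.+1 ^ y)%N in LL *.
  nia.
by rewrite ltn_pmul2r ?expn_gt0.
Qed.

(** * The polynomials X^q - b *)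

Section RadicalPolynomial.

Variable q : nat.
Hypothesis q_prime : prime q.

Definition radical_poly (b : int) : {poly int} := 'X^q - b%:P.

Lemma radical_poly_monic b : radical_poly b \is monic.
Proof. exact/monicXnsubC/prime_gt0. Qed.

Lemma size_radical_poly b : size (radical_poly b) = q.+1.
Proof. exact/size_XnsubC/prime_gt0. Qed.

Lemma map_radical_poly (R : nzRingType) b :
  map_poly intr (radical_poly b) = 'X^q - (b%:~R)%:P :> {poly R}.
Proof. by rewrite rmorphB /= map_polyXn map_polyC. Qed.

(** If [u * d = v * q + 1], then [b] is the [q]-th power of [c ^+ u / b ^+ v]. *)
Lemma coprime_power_root (F : fieldType) (b c : F) d :
  b != 0 -> coprime d q -> (0 < d)%N -> c ^+ q = b ^+ d -> exists r, b = r ^+ q.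
Proof.
move=> b0 cop d0 e; have [u v uv _] := egcdnP q d0; move: uv; rewrite (eqP cop) => uv.
exists (c ^+ u / b ^+ v); rewrite expr_div_n -!exprM [(u * q)%N]mulnC exprM e -exprM.
by rewrite mulnC uv exprD expr1 mulrAC divff ?mul1r // expf_neq0.
Qed.

Lemma rat_power_int (b : int) (r : rat) : b%:~R = r ^+ q -> exists d : int, b = d ^+ q.
Proof.
move=> e; pose z : algC := ratr r.
have zq : z ^+ q = b%:~R by rewrite -rmorphXn /= -e ratr_int.
have : z \is a Num.int.
  apply: Cint_rat_Aint; first exact: Crat_rat.
  apply: (@root_monic_Aint (map_poly intr (radical_poly b))).
  - by rewrite map_radical_poly rootE !hornerE zq subrr.
  - by rewrite monic_map // radical_poly_monic.
  - by apply/polyOverP => i; rewrite coef_map /=; apply: intr_int.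
case/intrP=> d zd; exists d; apply: (@intr_inj algC).
by rewrite -zq zd rmorphXn.
Qed.

(* The roots of a factor of degree [d] multiply, up to sign, to a rational number [c] with
   [c ^ q = b ^ d]; for [0 < d < q] this makes [b] itself a [q]-th power. *)
Lemma radical_poly_irreducible (b : int) : b != 0 ->
  (forall d : int, b <> d ^+ q) -> irreducible_over_rat (radical_poly b).
Proof.
move=> b0 nb; rewrite /irreducible_over_rat map_radical_poly.
set f := _ - _; have sf : size f = q.+1 by rewrite size_XnsubC ?prime_gt0.
have f0 : f != 0 by rewrite -size_poly_gt0 sf.
split; first by rewrite sf ltnS prime_gt0.
move=> g sg gf; rewrite -dvdp_size_eqp // sf.
have g0 : g != 0 by apply: contraTneq gf => ->; rewrite dvd0p.
pose gC : {poly algC} := map_poly ratr g; pose fC : {poly algC} := map_poly ratr f.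
have gfC : gC %| fC by rewrite dvdp_map.
have [rs Drs] := closed_field_poly_normal fC.
have fCE : fC = 'X^q - (b%:~R)%:P.
  by rewrite /fC rmorphB /= map_polyXn map_polyC /= ratr_int.
have lfC : lead_coef fC = 1 by rewrite fCE (monicP (monicXnsubC _ _)) ?prime_gt0.
rewrite lfC scale1r in Drs.
have rsq z : z \in rs -> z ^+ q = b%:~R.
  rewrite -root_prod_XsubC -Drs fCE rootE !hornerE subr_eq0 => /eqP //.
have : gC %| \prod_(z <- rs) ('X - z%:P) by rewrite -Drs.
case/dvdp_prod_XsubC => m; set ms := mask m rs => gE.
have sms : size g = (size ms).+1.
  by rewrite -(size_map_poly (ratr : {rmorphism rat -> algC})) (eqp_size gE) size_prod_XsubC.
have ms0 : (0 < size ms)%N by case: (size ms) sms sg => // ->.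
have msq : (size ms <= q)%N.
  by rewrite -ltnS -sms -sf dvdp_leq.
rewrite sms eqSS eqn_leq msq /= leqNgt; apply/negP => lt.
have cop : coprime (size ms) q.
  by rewrite coprime_sym prime_coprime // gtnNdvd.
have [c Ec] : exists c : rat, ratr c = \prod_(z <- ms) z.
  have /eqpP[[k1 k2] /andP[k10 k20] /= gk] := gE.
  exists ((-1) ^+ size ms * (g.[0] / lead_coef g)).
  have lg : lead_coef gC * k1 = k2.
    move/(congr1 lead_coef): gk; rewrite !lead_coefZ.
    by rewrite (monicP (monic_prod_XsubC _ _ _)) mulr1 mulrC.
  have : k1 * gC.[0] = k2 * ((-1) ^+ size ms * \prod_(z <- ms) z).
    have P s : \prod_(z <- s) ('X - z%:P).[0] = (-1) ^+ size s * \prod_(z <- s) z :> algC.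
      elim: s => [|z s IH]; first by rewrite !big_nil mulr1.
      by rewrite !big_cons IH !hornerE /= exprS; ring.
    by move/(congr1 (horner^~ 0)): gk; rewrite !hornerZ horner_prod P.
  rewrite -lg /gC lead_coef_map -{1}[0](rmorph0 (ratr : rat -> algC)) horner_map.
  rewrite !rmorphM fmorphV rmorphXn rmorphN1 /= mulrAC mulrC => /(mulIf k10) ->.
  rewrite mulrAC divff ?fmorph_eq0 ?lead_coef_eq0 // mul1r mulrA -exprD addnn -mul2n.
  by rewrite exprM sqrrN !expr1n mul1r.
have [r Er] : exists r : rat, b%:~R = r ^+ q.
  apply: (coprime_power_root (c := c) (d := size ms)) => //; first by rewrite intr_eq0.
  apply: (fmorph_inj (ratr : rat -> algC)); rewrite !rmorphXn /= Ec ratr_int.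
  rewrite -prodrXl big_seq_cond.
  rewrite (eq_bigr (fun=> b%:~R)); last by move=> z /andP[/mem_mask/rsq].
  by rewrite -big_seq_cond big_const_seq count_predT iter_mulr_1.
by have [d /nb] := rat_power_int Er.
Qed.

Lemma root_radical_poly (R : comNzRingType) b (y : R) :
  root (map_poly intr (radical_poly b)) y = (y ^+ q == b%:~R).
Proof. by rewrite map_radical_poly rootE !hornerE subr_eq0. Qed.

Lemma size_roots_le_nroots (f : {poly int}) p (s : seq 'F_p) : prime p -> uniq s ->
  all (root (map_poly intr f)) s -> (size s <= nroots f p)%N.
Proof.
move=> pp us /allP rs.
have lt (y : 'F_p) : (y < p)%N by rewrite -[X in (_ < X)%N](Fp_cast pp).
pose P := [pred r : 'I_p | (p %| absz f.[(r : nat)%:Z])%N].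
have -> : nroots f p = #|P|.
  rewrite -sum1_card big_mkcond /nroots; apply: eq_bigr => r _.
  by rewrite [r \in P]inE /=; case: (_ %| _)%N.
rewrite cardE -(size_map (fun y => Ordinal (lt y))); apply: uniq_leq_size.
  by rewrite map_inj_uniq // => x y [e]; apply: val_inj.
move=> _ /mapP[y ys ->]; rewrite mem_enum inE /= -intr_Fp_eq0 // -horner_map /= -pmulrn.
by rewrite -[X in _.[X]]/(y%:R) natr_Zp; apply: rs.
Qed.

Lemma Fp_expr_pred p (y : 'F_p) : prime p -> y != 0 -> y ^+ p.-1 = 1.
Proof.
move=> pp y0; apply: (mulfI y0); rewrite -exprS prednK ?prime_gt0 // mulr1.
by have := expf_card y; rewrite card_Fp.
Qed.

(** Raising to the power [q] permutes a group of order [p.-1] prime to [q]; its inverse is the power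
    [u] from Bezout. *)
Lemma coprime_power_Fp p (y : 'F_p) : prime p -> ~~ (q %| p.-1)%N -> exists z, y = z ^+ q.
Proof.
move=> pp nq; have [->|y0] := eqVneq y 0; first by exists 0; rewrite expr0n eqn0Ngt prime_gt0.
have [u v uv _] := egcdnP p.-1 (prime_gt0 q_prime).
have /eqP g1 : coprime q p.-1 by rewrite prime_coprime.
by exists (y ^+ u); rewrite -exprM uv g1 exprD mulnC exprM Fp_expr_pred // expr1n mul1r expr1.
Qed.

Lemma nroots_radical_gt0 b p : prime p -> ~~ (q %| p.-1)%N ->
  (0 < nroots (radical_poly b) p)%N.
Proof.
move=> pp nq; have [z bz] := coprime_power_Fp b%:~R pp nq.
by apply: (nroots_gt0 (y := z)) => //; rewrite root_radical_poly -bz.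
Qed.

(** With [p.-1 = m * q], the [m]-th power of [b] is 1 modulo [p]. Hence [X^q - b] divides
    [X^(p-1) - 1], and so [X^p - X], which splits with simple roots. *)
Lemma nroots_radical_ge b p (z : 'F_p) : prime p -> (q %| p.-1)%N -> ~~ (p %| absz b)%N ->
  z ^+ q = b%:~R -> (q <= nroots (radical_poly b) p)%N.
Proof.
move=> pp /dvdnP[m pm] pb zq.
have b0 : b%:~R != 0 :> 'F_p by rewrite intr_Fp_eq0.
have bm : (b%:~R : 'F_p) ^+ m = 1.
  have z0 : z != 0 by apply: contra b0 => /eqP z0; rewrite -zq z0 expr0n eqn0Ngt prime_gt0.
  by rewrite -zq -exprM mulnC -pm Fp_expr_pred.
have : map_poly intr (radical_poly b) %| \prod_(x <- index_enum 'F_p) ('X - x%:P).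
  rewrite -finField_genPoly card_Fp //.
  have -> : 'X^p - 'X = 'X * ('X^(p.-1) - 1) :> {poly 'F_p}.
    by rewrite mulrBr mulr1 -exprS prednK ?prime_gt0.
  have -> : 'X^(p.-1) - 1 = ('X^q) ^+ m - (b%:~R)%:P ^+ m :> {poly 'F_p}.
    by rewrite -exprM mulnC -pm -rmorphXn /= bm.
  by rewrite map_radical_poly subrXX dvdp_mull // dvdp_mulr.
case/dvdp_prod_XsubC => ms; set s := mask ms _ => E.
have us : uniq s by rewrite mask_uniq // index_enum_uniq.
suff <- : size s = q.
  apply: size_roots_le_nroots => //; apply/allP => y ys.
  by rewrite (eqp_root E) root_prod_XsubC.
apply/succn_inj; rewrite -(size_prod_XsubC s id) -(eqp_size E) map_radical_poly.
by rewrite size_XnsubC // prime_gt0.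
Qed.

End RadicalPolynomial.

(** * A field containing the q-th roots *)

(** Induction by the primitive element theorem for two elements, whose generator [th *+ m - x] is
    again an algebraic integer. *)
Lemma primitive_element (s : seq algC) : {subset s <= Aint} ->
  exists2 theta, theta \in Aint &
  forall x, x \in s -> exists g : {poly rat}, x = (map_poly ratr g).[theta].
Proof.
elim: s => [|x s IH] sA; first by exists 0; rewrite ?rpred0.
have [th thA Hth] : exists2 theta, theta \in Aint &
    forall x, x \in s -> exists g : {poly rat}, x = (map_poly ratr g).[theta].
  by apply: IH => y ys; apply: sA; rewrite inE ys orbT.
have [px [Dpx mpx _]] := minCpolyP x; have [pt [Dpt mpt _]] := minCpolyP th.
have rx : root (map_poly ratr px) x by rewrite -Dpx root_minCpoly.
have rt : root (map_poly ratr pt) th by rewrite -Dpt root_minCpoly.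
have char0 : has_char0 rat by exact: pchar_num.
have [m /= [[gx Hx] [gt Ht]]] := pchar0_PET (monic_neq0 mpx) rx (monic_neq0 mpt) rt char0.
exists (th *+ m - x); first by rewrite rpredB ?rpredMn // sA // inE eqxx.
move=> y; rewrite inE => /predU1P[->|/Hth[g ->]]; first by exists gx.
by exists (g \Po gt); rewrite map_comp_poly horner_comp Ht.
Qed.

Lemma minimal_int_poly (theta : algC) : theta \in Aint ->
  exists f : {poly int}, [/\ f \is monic, irreducible_over_rat f, (1 < size f)%N &
    forall g : {poly rat}, root (map_poly ratr g) theta = (map_poly intr f %| g)].
Proof.
move=> thA; have [p [Dp mp dvp]] := minCpolyP theta.
have /floorpP[f Df] : minCpoly theta \is a polyOver Num.int by [].
have fp : map_poly intr f = p.
  apply: (map_poly_inj (ratr : {rmorphism rat -> algC})).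
  rewrite -Dp Df -map_poly_comp; by apply: eq_map_poly => z /=; rewrite ratr_int.
have szp : (1 < size p)%N.
  by rewrite -(size_map_poly (ratr : {rmorphism rat -> algC})) -Dp size_minCpoly.
have szf : size f = size p by rewrite -fp size_map_inj_poly //; exact: intr_inj.
have p0 := monic_neq0 mp.
exists f; rewrite szf fp; split=> //.
- have /eqP := mp; rewrite -fp lead_coef_map_inj //; last exact: intr_inj.
  by move=> l1; apply/eqP/(@intr_inj rat); rewrite l1.
- rewrite /irreducible_over_rat fp; split=> // g sg /dvdpP[h Dg].
  have : root (map_poly ratr (h * g)) theta by rewrite -Dg dvp.
  have g0 : g != 0 by apply: contraNneq p0 => g0; rewrite Dg g0 mulr0.
  have h0 : h != 0 by apply: contraNneq p0 => h0; rewrite Dg h0 mul0r.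
  rewrite rmorphM rootM !dvp => /orP[ph|pg]; last by rewrite /eqp pg Dg dvdp_mull.
  have := dvdp_leq h0 ph; rewrite Dg size_mul //.
  have := g0; have := h0; have := sg; rewrite -(size_poly_gt0 g) -(size_poly_gt0 h) => /eqP.
  move: (size g) (size h) => a b; lia.
Qed.

Lemma clear_denominators (g : {poly rat}) : exists G : {poly int}, exists2 D : int,
  D != 0 & map_poly intr G = D%:~R *: g.
Proof.
have [G [D D0 ->]] := rat_poly_scale g; exists G; exists D => //.
by rewrite scalerA divff ?scale1r // intr_eq0.
Qed.

Lemma intr_Fp_neq0 (D : int) p : D != 0 -> prime p -> (absz D < p)%N ->
  (D%:~R != 0 :> 'F_p).
Proof.
move=> D0 pp lt; rewrite intr_Fp_eq0 // gtnNdvd // absz_gt0 //.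
Qed.

Lemma map_poly_intr_scale (D : int) (R : comNzRingType) (g : {poly int}) :
  map_poly intr (D *: g) = D%:~R *: map_poly intr g :> {poly R}.
Proof. by rewrite linearZ. Qed.

Section Reduction.

Variables (f : {poly int}) (theta : algC).
Hypothesis f_dvd : forall g : {poly rat},
  root (map_poly ratr g) theta = (map_poly intr f %| g).
Hypothesis f_irr : irreducible_over_rat f.

(** Over the rationals [f] divides [H]; clearing denominators gives [D *: H = K * f] over the
    integers, and [D] is invertible modulo every [p] above its absolute value. *)
Lemma root_mod_large (H : {poly int}) : root (map_poly intr H) theta ->
  exists y, forall p (r : 'F_p), prime p -> (y <= p)%N ->
    root (map_poly intr f) r -> root (map_poly intr H) r.
Proof.
move=> rH; have : map_poly intr f %| (map_poly intr H : {poly rat}).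
  rewrite -f_dvd -map_poly_comp; rewrite (eq_map_poly (g := intr)) // => z /=.
  by rewrite ratr_int.
case/dvdpP=> k Dk; have [K [D D0 EK]] := clear_denominators k.
have E : D *: H = K * f.
  apply: (map_inj_poly (f := intr : int -> rat)); [exact: intr_inj | by rewrite rmorph0 |].
  by rewrite rmorphM /= EK map_poly_intr_scale Dk scalerAl.
exists (absz D).+1 => p r pp lt /eqP fr.
have D0p := intr_Fp_neq0 D0 pp lt.
have := congr1 (fun g => (map_poly intr g : {poly 'F_p}).[r]) E.
rewrite /= map_poly_intr_scale rmorphM hornerZ hornerM fr mulr0 => /eqP.
by rewrite mulf_eq0 (negPf D0p).
Qed.

(** A Bezout relation between [f] and [H], cleared of denominators, yields a nonzero integer, which
    no large [p] divides. *)
Lemma nroot_mod_large (H : {poly int}) : ~~ root (map_poly intr H) theta ->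
  exists y, forall p (r : 'F_p), prime p -> (y <= p)%N ->
    root (map_poly intr f) r -> ~~ root (map_poly intr H) r.
Proof.
move=> rH; set fQ : {poly rat} := map_poly intr f; set HQ : {poly rat} := map_poly intr H.
have nd : ~~ (fQ %| HQ).
  rewrite -f_dvd -map_poly_comp (eq_map_poly (g := intr)) // => z /=.
  by rewrite ratr_int.
have cop : coprimep fQ HQ.
  have [_ /(_ (gcdp fQ HQ)) ir] := f_irr.
  apply/negPn/negP => nc; have := ir nc (dvdp_gcdl _ _) => /eqp_dvdl e.
  by move: nd; rewrite -e dvdp_gcdr.
have [[u v] /= uv] := Bezout_eq1_coprimepP _ _ cop.
have [U [D D0 EU]] := clear_denominators u; have [V [D' D'0 EV]] := clear_denominators v.
have E : D' *: U * f + D *: V * H = (D * D')%:P.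
  apply: (map_inj_poly (f := intr : int -> rat)); [exact: intr_inj | by rewrite rmorph0 |].
  rewrite rmorphD !rmorphM /= !map_poly_intr_scale EU EV !map_polyC /=.
  rewrite !scalerA -!scalerAl [D'%:~R * _]mulrC -scalerDr.
  by rewrite -/fQ -/HQ uv -polyCM -mul_polyC mulr1.
exists (absz (D * D')).+1 => p r pp lt /eqP fr; apply/negP => /eqP Hr.
have DD0 : D * D' != 0 by rewrite mulf_neq0.
have := congr1 (fun g => (map_poly intr g : {poly 'F_p}).[r]) E.
rewrite /= rmorphD !rmorphM /= map_polyC !hornerE /= fr Hr !mulr0 addr0 => /esym/eqP.
by apply/negP; rewrite map_polyC hornerC -intrM; apply: intr_Fp_neq0.
Qed.

End Reduction.

(** [f] is the minimal polynomial of a generator [theta] of a field containing a primitive [q]-th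
    root of unity [w] and a [q]-th root of each [b]. Sending [theta] to a root of [f] modulo a large
    [p] reduces these elements to ['F_p]. *)
Theorem splitting_polynomial q (bs : seq int) : prime q ->
  exists f : {poly int}, exists2 y : nat,
    [/\ f \is monic, irreducible_over_rat f & (1 < size f)%N] &
    forall p, prime p -> (y <= p)%N -> (0 < nroots f p)%N ->
      (q %| p.-1)%N /\ forall b, b \in bs -> exists z : 'F_p, z ^+ q = b%:~R.
Proof.
move=> qp; have q0 := prime_gt0 qp.
have [w prim_w] := C_prim_root_exists q0.
have w1 : w != 1.
  by rewrite -[w]expr1 -(prim_order_dvd prim_w) dvdn1; case: eqP qp => // ->.
have [theta thA Hth] : exists2 theta, theta \in Aint & forall x,
    x \in w :: [seq q.-root (b%:~R : algC) | b <- bs] ->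
    exists g : {poly rat}, x = (map_poly ratr g).[theta].
  apply: primitive_element => x; rewrite inE => /predU1P[->|/mapP[b _ ->]].
    exact: Aint_prim_root prim_w.
  apply: (@root_monic_Aint (map_poly intr (radical_poly q b))).
  - by rewrite root_radical_poly rootCK.
  - by rewrite monic_map // radical_poly_monic.
  - by apply/polyOverP => i; rewrite coef_map /=; apply: intr_int.
have [f [mf irf sf dvf]] := minimal_int_poly thA.
(* Here [x = G(theta) / D], and its reduction is [G(r) / D]. The root of unity [w] is the case
   [b = 1]. *)
have power_mod x (b : int) : x \in w :: [seq q.-root (b%:~R : algC) | b <- bs] ->
    x ^+ q = b%:~R ->
    exists G : {poly int}, exists D : int, exists y : nat, [/\ D != 0,
      (map_poly intr G).[theta] = D%:~R * x &
      forall p (r : 'F_p), prime p -> (y <= p)%N -> root (map_poly intr f) r ->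
      D%:~R != 0 :> 'F_p /\ ((map_poly intr G).[r] / D%:~R) ^+ q = b%:~R].
  move=> /Hth[g xg] xq; have [G [D D0 EG]] := clear_denominators g.
  have Gth : (map_poly intr G).[theta] = D%:~R * x.
    have -> : map_poly intr G = map_poly ratr (map_poly intr G : {poly rat}) :> {poly algC}.
      by rewrite -map_poly_comp; apply: eq_map_poly => z /=; rewrite ratr_int.
    by rewrite EG map_polyZ hornerZ /= ratr_int xg.
  pose H : {poly int} := G ^+ q - (D ^+ q * b)%:P.
  have mapH (R : comNzRingType) (t : R) :
      (map_poly intr H).[t] = (map_poly intr G).[t] ^+ q - D%:~R ^+ q * b%:~R.
    by rewrite rmorphB rmorphXn /= map_polyC !hornerE /= intrM rmorphXn.
  have rH : root (map_poly intr H) theta.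
    by rewrite rootE mapH Gth exprMn xq subrr.
  have [y Hy] := root_mod_large dvf rH.
  exists G, D, (maxn y (absz D).+1); split=> // p r pp; rewrite geq_max => /andP[yp Dp] rf.
  have D0p := intr_Fp_neq0 D0 pp Dp; split=> //.
  have := Hy p r pp yp rf; rewrite rootE mapH subr_eq0 expr_div_n => /eqP->.
  by rewrite mulrAC divff ?mul1r // expf_neq0.
have [Gw [Dw [yw [Dw0 Gwth Hw]]]] := power_mod w 1 (mem_head _ _) (prim_expr_order prim_w).
(* [w] must stay different from 1 after reduction. *)
have [yn Hn] : exists y, forall p (r : 'F_p), prime p -> (y <= p)%N ->
    root (map_poly intr f) r -> ~~ root (map_poly intr (Gw - Dw%:P)) r.
  apply: (nroot_mod_large dvf irf).
  rewrite rootE rmorphB /= map_polyC !hornerE /= Gwth -[X in _ - X]mulr1 -mulrBr.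
  by rewrite mulf_neq0 ?intr_eq0 ?subr_eq0.
have [yb Hb] : exists y, forall p (r : 'F_p), prime p -> (y <= p)%N ->
    root (map_poly intr f) r -> forall b, b \in bs -> exists z : 'F_p, z ^+ q = b%:~R.
  have sub b : b \in bs -> exists y, forall p (r : 'F_p), prime p -> (y <= p)%N ->
      root (map_poly intr f) r -> exists z : 'F_p, z ^+ q = b%:~R.
    move=> bbs; have [||G [D [y [_ _ HG]]]] := power_mod (q.-root b%:~R) b.
    - by rewrite inE; apply/orP; right; apply: (map_f (fun b : int => q.-root (b%:~R : algC))).
    - by rewrite rootCK.
    exists y => p r pp yp rf; have [_ e] := HG p r pp yp rf.
    by exists ((map_poly intr G).[r] / D%:~R).
  elim: (bs) sub => [|b s IH] sub; first by exists 0%N.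
  have [|y1 H1] := IH; first by move=> c cs; apply: sub; rewrite inE cs orbT.
  have [|y2 H2] := sub b; first exact: mem_head.
  exists (maxn y1 y2) => p r pp; rewrite geq_max => /andP[p1 p2] rf c.
  by rewrite inE => /predU1P[->|]; [apply: H2 rf | apply: H1 rf c].
exists f, (maxn yw (maxn yn yb)) => // p pp; rewrite !geq_max => /and3P[pw pn pb] nr.
have [r rf] : exists r : 'F_p, root (map_poly intr f) r.
  move: nr; rewrite /nroots lt0n sum_nat_eq0 negb_forall => /existsP[r].
  rewrite implyTb eqb0 negbK => fr; exists ((r : nat)%:Z%:~R).
  by rewrite rootE horner_map /= intr_Fp_eq0.
split; last exact: (Hb p r).
have [Dp0 e] := Hw p r pp pw rf; set t := _ / _ in e.
apply: contraT => nq.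
have t1 : t != 1.
  have := Hn p r pp pn rf; rewrite rootE rmorphB /= map_polyC !hornerE /= subr_eq0.
  by apply: contra => /eqP t1; rewrite -[eqbLHS](divfK Dp0) -/t t1 mul1r.
(* If [q] were prime to [p.-1], then [t ^+ q = 1] and [t ^+ p.-1 = 1] would force [t = 1]. *)
have [u v uv _] := egcdnP p.-1 q0.
have /eqP g1 : coprime q p.-1 by rewrite prime_coprime.
have t0 : t != 0.
  apply: contraTneq isT => t0; move: e.
  by rewrite t0 expr0n eqn0Ngt q0 rmorph1 => /esym/eqP; rewrite oner_eq0.
have : t ^+ (u * q) = 1 by rewrite mulnC exprM e rmorph1 expr1n.
rewrite uv g1 exprD mulnC exprM Fp_expr_pred // expr1n mul1r expr1 => t1'.
by rewrite t1' eqxx in t1.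
Qed.

(** * Comparison of the Euler products *)

Section Products.

Variables (R : realFieldType) (I : eqType).

Lemma prod_1D_ge (r : seq I) (x : I -> R) : {in r, forall i, 0 <= x i} ->
  1 + \sum_(i <- r) x i <= \prod_(i <- r) (1 + x i).
Proof.
elim: r => [|i r IH] x0; first by rewrite !big_nil addr0.
have xi : 0 <= x i by apply: x0; rewrite mem_head.
have xr : {in r, forall i, 0 <= x i} by move=> j jr; apply: x0; rewrite inE jr orbT.
rewrite !big_cons; apply: le_trans (ler_wpM2l _ (IH xr)); last by rewrite addr_ge0.
have s0 : 0 <= \sum_(j <- r) x j by rewrite big_seq sumr_ge0.
rewrite mulrDr mulr1 mulrDl mul1r; have := mulr_ge0 xi s0; lra.
Qed.

Lemma prod_1B_ge (r : seq I) (x : I -> R) : {in r, forall i, 0 <= x i <= 1} ->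
  1 - \sum_(i <- r) x i <= \prod_(i <- r) (1 - x i).
Proof.
elim: r => [|i r IH] x0; first by rewrite !big_nil subr0.
have /andP[xi0 xi1] : 0 <= x i <= 1 by apply: x0; rewrite mem_head.
have xr : {in r, forall i, 0 <= x i <= 1} by move=> j jr; apply: x0; rewrite inE jr orbT.
rewrite !big_cons; apply: le_trans (ler_wpM2l _ (IH xr)); last by rewrite subr_ge0.
have s0 : 0 <= \sum_(j <- r) x j.
  by rewrite big_seq sumr_ge0 // => j /xr/andP[].
rewrite mulrBr mulr1 mulrBl mul1r; have := mulr_ge0 xi0 s0; lra.
Qed.

Lemma prod_ge1 (r : seq I) (x : I -> R) : {in r, forall i, 1 <= x i} ->
  1 <= \prod_(i <- r) x i.
Proof.
move=> x1; rewrite big_seq; elim/big_ind: _ => // a b a1 b1.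
by rewrite -[1]mulr1 ler_pM.
Qed.

Lemma prod_ge_factor (r : seq I) (x : I -> R) i : i \in r ->
  {in r, forall i, 1 <= x i} -> x i <= \prod_(i <- r) x i.
Proof.
move=> ir x1; rewrite (big_rem i) //= ler_peMr //; first by rewrite (le_trans ler01) ?x1.
by apply: prod_ge1 => j /mem_rem/x1.
Qed.


Lemma bernoulli_sub (t : R) m : 0 <= t <= 1 -> 1 - m%:R * t <= (1 - t) ^+ m.
Proof.
move=> /andP[t0 t1]; elim: m => [|m IH]; first by rewrite mul0r subr0.
rewrite exprS; apply: le_trans (ler_wpM2l _ IH); last by rewrite subr_ge0.
rewrite -natr1 mulrBr mulr1 mulrBl mul1r mulrDl mul1r.
have : 0 <= t * (m%:R * t) by rewrite !mulr_ge0 ?ler0n.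
lra.
Qed.

(* [rho b] is the number of roots of [X ^ q - b] modulo a prime [p], and
   [t = p ^ - (1 + e)]. *)
Lemma local_factor_ge (bs : seq I) (rho : I -> nat) q (t : R) (s : bool) :
  (2 <= q)%N -> (0 < size bs <= q)%N -> 0 <= t -> q%:R * t <= 1 ->
  (if s then {in bs, forall b, q <= rho b}%N
   else {in bs, forall b, 1 <= rho b}%N \/ exists2 b, b \in bs & (q <= rho b)%N) ->
  (1 - q%:R ^+ 2 * t ^+ 2) * (1 + s%:R * t) <=
  (1 - t) ^+ size bs * \prod_(b <- bs) (1 + (rho b)%:R * t).
Proof.
move=> q2 /andP[m0 mq] t0 qt.
have q2R : 2 <= q%:R :> R by rewrite ler_nat.
have t1 : 0 <= t <= 1 by rewrite t0 /=; nra.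
have [_ t1'] := andP t1.
have f1 b : 1 <= 1 + (rho b)%:R * t by rewrite lerDl mulr_ge0 ?ler0n.
(* [size bs <= q] enters: one element with [q] roots already offsets the factor
   [(1 - t) ^+ size bs], up to second order. *)
have powm : 1 - q%:R * t <= (1 - t) ^+ size bs.
  apply: le_trans (bernoulli_sub _ t1) _; apply: ler_wiXn2l => //; lra.
have prod_le (c : nat) : {in bs, forall b, c <= rho b}%N ->
    (1 + c%:R * t) ^+ size bs <= \prod_(b <- bs) (1 + (rho b)%:R * t).
  elim: (bs) => [|b r IH] H; first by rewrite big_nil.
  rewrite big_cons exprS ler_pM ?exprn_ge0 ?addr_ge0 ?mulr_ge0 ?ler0n //.
    by rewrite lerD2l ler_wpM2r // ler_nat H ?mem_head.
  by apply: IH => c' cr; apply: H; rewrite inE cr orbT.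
have qt0 : 0 <= 1 - q%:R * t by lra.
case: s => [/prod_le Hq|[/prod_le H1|[b bbs qb]]].
(* A single element leaves [(1 - t) * (1 + q * t)]. With two or more, one factor [1 + q * t]
   combines with [1 - q * t] and another one remains. *)
- rewrite mul1r; case: (size bs) m0 mq powm Hq => [|[|m]] // _ _ powm Hq.
    rewrite expr1 in Hq *; apply: le_trans (ler_wpM2l _ Hq); last by lra.
    rewrite expr1; nra.
  apply: (@le_trans _ _ ((1 - q%:R * t) * (1 + q%:R * t) ^+ 2)).
    rewrite -exprMn -[X in X - _](expr1n _ 2) subr_sqr -mulrA ler_wpM2l //.
    by rewrite expr2 ler_wpM2l ?lerD2l; nra.
  apply: ler_pM => //; first by rewrite exprn_ge0 // addr_ge0 // mulr_ge0 ?ler0n.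
  apply: le_trans Hq; apply: ler_weXn2l => //; by rewrite lerDl mulr_ge0 ?ler0n.
- rewrite mul0r addr0 mulr1.
  apply: le_trans (ler_wpM2l _ H1); last by rewrite exprn_ge0 // subr_ge0.
  rewrite -[leRHS]exprMn.
  have -> : (1 - t) * (1 + 1%:R * t) = 1 - t ^+ 2 by ring.
  apply: (@le_trans _ _ (1 - (size bs)%:R * t ^+ 2)).
    rewrite lerD2l lerN2 ler_wpM2r ?exprn_ge0 // -natrX ler_nat (leq_trans mq) //.
    by rewrite expnS expn1 leq_pmulr // ltnW.
  by apply: bernoulli_sub; rewrite exprn_ge0 //= expr_le1.
- rewrite mul0r addr0 mulr1.
  apply: (@le_trans _ _ ((1 - q%:R * t) * (1 + q%:R * t))); first by nra.
  apply: ler_pM => //; first by rewrite addr_ge0 // mulr_ge0 ?ler0n.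
  apply: le_trans (prod_ge_factor bbs _); last by move=> *; apply: f1.
  by rewrite lerD2l ler_wpM2r // ler_nat.
Qed.

End Products.

Lemma prod_roots_bound_seq (R : realType) q (bs : seq int) : prime q ->
  (forall b, b \in bs -> b != 0 /\ forall d : int, b <> d ^+ q) ->
  exists2 A : R, 0 < A & forall b (e : R) N, b \in bs -> 0 < e -> e <= 1 ->
    \prod_(0 <= p < N | prime p) (1 + (nroots (radical_poly q b) p)%:R * wt (1 + e) p) <= A / e.
Proof.
move=> qp; elim: bs => [|b bs IH] H; first by exists 1.
have [|A A0 HA] := IH; first by move=> c cs; apply: H; rewrite inE cs orbT.
have [b0 nb] := H b (mem_head _ _).
have szb : size (radical_poly q b) = q.-1.+2 by rewrite size_radical_poly // prednK ?prime_gt0.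
have [A' A'0 HA'] := @prod_roots_bound R _ _ (radical_poly_monic qp b) szb
  (radical_poly_irreducible qp b0 nb).
exists (A + A'); first exact: addr_gt0.
move=> c e N; rewrite inE => /predU1P[->|cbs] e0 e1.
  by apply: le_trans (HA' e N e0 e1) _; rewrite ler_pM2r ?invr_gt0 // lerDr ltW.
by apply: le_trans (HA c e N cbs e0 e1) _; rewrite ler_pM2r ?invr_gt0 // lerDl ltW.
Qed.

Section LocalPowers.

Variables (R : realType) (q : nat) (bs : seq int) (f : {poly int}) (y : nat).
Hypotheses (q_prime : prime q) (size_bs : (0 < size bs <= q)%N).
Hypothesis bs_spec : forall b, b \in bs -> b != 0 /\ forall d : int, b <> d ^+ q.
Hypothesis y_large : (2 * q ^ 2 < y)%N.

Let split p := (0 < nroots f p)%N.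

Hypothesis many_roots : forall p, prime p -> (y <= p)%N ->
  if split p then {in bs, forall b, q <= nroots (radical_poly q b) p}%N
  else {in bs, forall b, 1 <= nroots (radical_poly q b) p}%N \/
       exists2 b, b \in bs & (q <= nroots (radical_poly q b) p)%N.

Let primes_from N := [seq p <- index_iota y N | prime p].

Let primes_fromP N p : p \in primes_from N -> [/\ prime p, (y <= p)%N & (p < N)%N].
Proof. by rewrite mem_filter mem_index_iota => /and3P[]. Qed.

(** The local inequality is multiplied over the primes from [y] to [N]. Its [m] copies of the
    truncated zeta product are each at least a constant over [e], the [m] upper bounds are each
    [A / e], and the powers of [e] cancel. *)
Lemma split_weight_bounded : exists M : R, forall e N, 0 < e -> e <= 1 ->
  \sum_(p <- primes_from N) (split p)%:R * wt (1 + e) p <= M.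
Proof.
have q2 : (1 < q)%N by exact: prime_gt1.
have [A A0 HA] := @prod_roots_bound_seq R q bs q_prime bs_spec.
pose m := size bs; exists (2 * (2 ^+ y.+1 * A) ^+ m) => e N' e0 e1.
(* Enlarging the range to reach [wt e N <= 1/2] makes the truncated sum of [wt (1 + e) k] at least
   [1 / (2 * e)]. *)
have [N0 HN0] := wt_small e0; pose N := maxn N' (maxn y.+1 N0).
have [N'N yN N0N] : [/\ N' <= N, y < N & N0 <= N]%N.
  by rewrite /N; split; rewrite ?leq_max ?leqnn ?orbT.
pose t := wt (1 + e).
have t0 p : 0 <= t p by apply: wt_ge0.
have tp p : (0 < p)%N -> t p <= p%:R^-1 by move=> p0; apply: wt1D_le => //; apply: ltW.
apply: (@le_trans _ _ (\sum_(p <- primes_from N) (split p)%:R * t p)).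
  have [yN'|N'y] := leqP y N'; last first.
    rewrite /primes_from /index_iota (_ : (N' - y = 0)%N) ?big_nil; last by lia.
    by rewrite sumr_ge0 // => p _; rewrite mulr_ge0 ?ler0n.
  rewrite /primes_from !big_filter [leRHS](big_cat_nat (n := N')) //= lerDl.
  by rewrite sumr_ge0 // => p _; rewrite mulr_ge0 ?ler0n.
have qt p : p \in primes_from N -> 0 <= q%:R ^+ 2 * t p ^+ 2 <= 1 /\ q%:R * t p <= 1.
  case/primes_fromP => pp yp _; have p0 := prime_gt0 pp; have p0R : 0 < p%:R :> R by rewrite ltr0n.
  have qt1 : q%:R * t p <= 1.
    apply: (@le_trans _ _ (q%:R * p%:R^-1)); first by rewrite ler_wpM2l ?ler0n ?tp.
    rewrite ler_pdivrMr // mul1r ler_nat; nia.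
  by rewrite -exprMn exprn_ge0 ?mulr_ge0 ?ler0n //= expr_le1 ?mulr_ge0 ?ler0n.
pose E := \prod_(p <- primes_from N) (1 - t p)^-1.
have t_half p : prime p -> t p <= 2^-1.
  move=> pp; apply: le_trans (tp _ (prime_gt0 pp)) _.
  by rewrite lef_pV2 ?posrE ?ltr0n ?prime_gt0 // ler_nat prime_gt1.
have t_inv p : prime p -> 0 < (1 - t p)^-1 <= 2.
  move=> pp; have := t_half p pp => th; have h : 0 < 1 - t p by lra.
  by rewrite invr_gt0 h /= -(ler_pM2l h) divff ?lt0r_neq0 //; lra.
have E_pos : 0 < E.
  by rewrite /E big_seq prodr_gt0 // => p /primes_fromP[pp _ _]; case/andP: (t_inv p pp).
have E_ge : (2 ^+ y.+1 * e)^-1 <= E.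
  (* Each Euler factor below [y] is at most 2, so dropping them costs at most [2 ^+ y]. *)
  have euler : \sum_(1 <= k < N) t k <= 2 ^+ y * E.
    apply: le_trans (sum_le_euler_prod N (wt1 _) (wtM _) t0 _) _.
      by move=> p pp; rewrite (le_lt_trans (t_half p pp)) // invf_lt1 // ltr1n.
    rewrite (big_cat_nat (n := y)) ?(ltnW yN) //= /E big_filter.
    rewrite ler_wpM2r //; first by apply: ltW; rewrite prodr_gt0 // => p /t_inv/andP[].
    rewrite -[X in 2 ^+ X]subn0 -prodr_const_nat big_mkcond.
    apply: ler_prod => p _; case: ifP => [/t_inv/andP[/ltW-> ->]//|_].
    by rewrite ler01 ler1n.
  have low := le_trans (sum_wt_ge e0 (leq_ltn_trans (leq0n _) yN)) euler.
  rewrite -(@ler_pM2l _ (2 ^+ y)) ?exprn_gt0 //; apply: le_trans low.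
  have -> : 2 ^+ y * (2 ^+ y.+1 * e)^-1 = 2^-1 / e :> R.
    by rewrite exprS -mulrA !invfM mulrCA mulVKf ?expf_neq0 ?pnatr_eq0.
  rewrite ler_pM2r ?invr_gt0 //.
  by have := HN0 N N0N; lra.
have upper : \prod_(b <- bs) \prod_(p <- primes_from N)
    (1 + (nroots (radical_poly q b) p)%:R * t p) <= (A / e) ^+ m.
  rewrite /m; have : {subset bs <= bs} by [].
  elim: {-2}bs => [|b s IH] sub; first by rewrite big_nil.
  rewrite big_cons exprS; apply: ler_pM.
  - by rewrite prodr_ge0 // => p _; rewrite addr_ge0 ?mulr_ge0 ?ler0n.
  - by rewrite prodr_ge0 // => c _; rewrite prodr_ge0 // => p _; rewrite addr_ge0 ?mulr_ge0 ?ler0n.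
  - apply: le_trans (HA b e N (sub _ (mem_head _ _)) e0 e1).
    rewrite [leRHS](big_cat_nat (n := y)) ?(ltnW yN) //= big_filter ler_peMl //.
      by rewrite prodr_ge0 // => p _; rewrite addr_ge0 ?mulr_ge0 ?ler0n.
    rewrite -big_filter; apply: prod_ge1 => p _; by rewrite lerDl mulr_ge0 ?ler0n.
  - by apply: IH => c cs; apply: sub; rewrite inE cs orbT.
have lower : \prod_(p <- primes_from N) (1 - q%:R ^+ 2 * t p ^+ 2) *
    \prod_(p <- primes_from N) (1 + (split p)%:R * t p) * E ^+ m <= (A / e) ^+ m.
  have -> : \prod_(p <- primes_from N) (1 - q%:R ^+ 2 * t p ^+ 2) *
      \prod_(p <- primes_from N) (1 + (split p)%:R * t p) * E ^+ m =
      \prod_(p <- primes_from N) ((1 - q%:R ^+ 2 * t p ^+ 2) *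
        (1 + (split p)%:R * t p) * (1 - t p)^-1 ^+ m).
    by rewrite !big_split prodrXl.
  apply: le_trans upper; rewrite exchange_big /=.
  rewrite big_seq [leRHS]big_seq; apply: ler_prod => p pN; have [pp yp _] := primes_fromP pN.
  have [/andP[sq0 sq1] qt1] := qt p pN; have [i0 i2] := andP (t_inv p pp).
  have f1 : 0 <= 1 - q%:R ^+ 2 * t p ^+ 2 by rewrite subr_ge0.
  have f2 : 0 <= 1 + (split p)%:R * t p by rewrite addr_ge0 ?mulr_ge0 ?ler0n.
  apply/andP; split; first by rewrite !mulr_ge0 // exprn_ge0 // ltW.
  have h0 : 0 < 1 - t p by rewrite -invr_gt0.
  have c1 : (1 - t p) ^+ m * (1 - t p)^-1 ^+ m = 1.
    by rewrite -exprMn divff ?expr1n ?lt0r_neq0.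
  have L := local_factor_ge (prime_gt1 q_prime) size_bs (t0 p) qt1 (many_roots pp yp).
  apply: le_trans (ler_wpM2r _ L) _; first by rewrite exprn_ge0 // ltW.
  by rewrite mulrAC c1 mul1r.
(* The sum of [q ^ 2 / p ^ 2] from [y] on is at most [q ^ 2 / (y - 1)], which is at most [1/2] since
   [2 * q ^ 2 < y]. *)
have half : 2^-1 <= \prod_(p <- primes_from N) (1 - q%:R ^+ 2 * t p ^+ 2).
  apply: le_trans (prod_1B_ge (x := fun p => q%:R ^+ 2 * t p ^+ 2) _); last by move=> p /qt[].
  rewrite lerBrDr -lerBrDl.
  have : \sum_(p <- primes_from N) q%:R ^+ 2 * t p ^+ 2 <=
      q%:R ^+ 2 * \sum_(y <= p < N) p%:R ^- 2.
    rewrite -mulr_sumr ler_wpM2l ?exprn_ge0 ?ler0n // /primes_from big_filter big_mkcond.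
    rewrite !big_nat; apply: ler_sum => p /andP[yp _].
    case: ifP => [pp|_]; last by rewrite invr_ge0 exprn_ge0 ?ler0n.
    by rewrite -exprVn lerXn2r ?nnegrE ?t0 ?invr_ge0 ?ler0n //; apply/tp/prime_gt0.
  move/le_trans; apply; apply: (@le_trans _ _ (q%:R ^+ 2 * (y.-1%:R)^-1)).
    rewrite ler_wpM2l ?exprn_ge0 ?ler0n // sum_inv_squares_le //; nia.
  have y1 : 0 < y.-1%:R :> R by rewrite ltr0n; nia.
  rewrite ler_pdivrMr // (_ : 1 - 2^-1 = 2^-1); last by field.
  rewrite ler_pdivlMl // -natrX -natrM ler_nat; nia.
apply: (@le_trans _ _ (\prod_(p <- primes_from N) (1 + (split p)%:R * t p))).
  apply: le_trans (prod_1D_ge _); first by rewrite lerDr.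
  by move=> p _; rewrite mulr_ge0 ?ler0n.
set P := \prod_(p <- _) (1 + (split p)%:R * t p) in lower *.
have P0 : 0 <= P by rewrite /P prodr_ge0 // => p _; rewrite addr_ge0 ?mulr_ge0 ?ler0n.
have Em : (2 ^+ y.+1 * e)^-1 ^+ m <= E ^+ m.
  by rewrite lerXn2r ?nnegrE ?(ltW E_pos) // invr_ge0 mulr_ge0 ?exprn_ge0 // ltW.
have c0 : 0 < (2 ^+ y.+1 * e)^-1 ^+ m by rewrite exprn_gt0 // invr_gt0 mulr_gt0 ?exprn_gt0.
have : 2^-1 * P * (2 ^+ y.+1 * e)^-1 ^+ m <= (A / e) ^+ m.
  apply: le_trans lower; apply: ler_pM Em; [|exact: ltW|exact: ler_wpM2r].
  by rewrite mulr_ge0 // invr_ge0.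
rewrite -ler_pdivlMr // exprVn invrK -exprMn.
have -> : A / e * (2 ^+ y.+1 * e) = 2 ^+ y.+1 * A by field; rewrite lt0r_neq0.
by move=> h; rewrite -ler_pdivrMl.
Qed.

End LocalPowers.

(** * Primes modulo which no element is a power *)

Lemma prime_without_power q (bs : seq int) y0 : prime q -> (size bs <= q)%N ->
  (forall b, b \in bs -> b != 0 /\ forall d : int, b <> d ^+ q) ->
  exists p, [/\ prime p, (y0 <= p)%N &
    forall b (z : 'F_p), b \in bs -> z ^+ q <> b%:~R].
Proof.
move=> qp sq bsP; apply: contrapT => none.
have {none} some p : prime p -> (y0 <= p)%N ->
    exists2 b, b \in bs & exists z : 'F_p, z ^+ q = b%:~R.
  move=> pp yp; apply: contrapT => H; apply: none; exists p; split=> // b z bbs zb.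
  by apply: H; exists b => //; exists z.
have s0 : (0 < size bs)%N.
  have [p yp pp] := prime_above y0; have [b bbs _] := some p pp (ltnW yp).
  by case: (bs) bbs.
have [f [y1 [mf irf sf] Hf]] := splitting_polynomial bs qp.
(* The last term ensures that no prime from [y] on divides an element of [bs]. *)
pose y := maxn (maxn y0 y1) (maxn (2 * q ^ 2).+1 (\max_(b <- bs) absz b).+1).
have [y0y y1y qy by_] : [/\ y0 <= y, y1 <= y, 2 * q ^ 2 < y & \max_(b <- bs) absz b < y]%N.
  by rewrite /y; split; rewrite !leq_max leqnn ?orbT.
have pb p b : (y <= p)%N -> b \in bs -> ~~ (p %| absz b)%N.
  move=> yp bbs; have [b0 _] := bsP b bbs; apply/negP => /dvdn_leq; rewrite absz_gt0 => /(_ b0).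
  have : (absz b <= \max_(c <- bs) absz c)%N by apply: leq_bigmax_seq.
  lia.
have many p : prime p -> (y <= p)%N -> if (0 < nroots f p)%N
    then {in bs, forall b, q <= nroots (radical_poly q b) p}%N
    else {in bs, forall b, 1 <= nroots (radical_poly q b) p}%N \/
         exists2 b, b \in bs & (q <= nroots (radical_poly q b) p)%N.
  move=> pp yp; case: ifP => [nf|_].
    have [qp1 Hz] := Hf p pp (leq_trans y1y yp) nf; move=> b bbs.
    have [z zb] := Hz b bbs; exact: nroots_radical_ge (pb _ _ yp bbs) zb.
  have [qp1|nq] := boolP (q %| p.-1)%N; last by left=> b _; apply: nroots_radical_gt0.
  right; have [b bbs [z zb]] := some p pp (leq_trans y0y yp).
  by exists b => //; apply: nroots_radical_ge (pb _ _ yp bbs) zb.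
pose R : realType := Rdefinitions.R.
have sbs : (0 < size bs <= q)%N by rewrite s0.
have [M HM] := @split_weight_bounded R q bs f y qp sbs bsP qy many.
have szf : size f = (size f).-2.+2 by case: (size f) sf => [|[]].
have [N] := @split_primes_diverge R f _ y (2 * M) mf szf irf.
rewrite ltNge => /negP; apply.
(* With [e = 1 / N.+1], each [p < N] satisfies [1 / p <= 2 * wt (1 + e) p], so [M] would bound the
   divergent sum by [2 * M]. *)
have e0 : 0 < N.+1%:R^-1 :> R by rewrite invr_gt0 ltr0n.
have e1 : N.+1%:R^-1 <= 1 :> R by rewrite invf_le1 ?ltr0n // ler1n.
apply: le_trans (ler_wpM2l _ (HM _ N e0 e1)); last by [].
rewrite big_filter mulr_sumr big_mkcondr /= [leLHS]big_nat_cond [leRHS]big_nat_cond.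
apply: ler_sum => p /andP[/andP[_ pN] pp]; have p0 := prime_gt0 pp.
case: ifP => _; last by rewrite mul0r mulr0.
rewrite mul1r -ler_pdivrMl // -invfM; apply: wt_small_exponent => //; first exact: ltW.
by rewrite mulrC ler_pdivrMr ?ltr0n // mul1r ler_nat ltnW // ltnW.
Qed.

(** * Coverings by proper subspaces *)

(** For [v] outside [U], the vectors [u + c *: v] with [u] in [U] are pairwise distinct. *)
Lemma card_proper_vspace (F : finFieldType) k (U : {vspace 'rV[F]_k}) :
  U != fullv -> (#|[set x | x \in U]| * #|F| <= #|{: 'rV[F]_k}|)%N.
Proof.
move=> nU; have /subvPn[v _ vU] : ~~ (fullv <= U)%VS.
  by apply: contra nU; rewrite eqEsubv subvf.
rewrite -(cardsT F) -cardsX.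
rewrite -(@card_in_imset _ _ (fun uc : 'rV[F]_k * F => (uc.1 + uc.2 *: v)%R)).
  exact: max_card.
move=> [u c] [u' c'] /setXP[+ _] /setXP[+ _] /= e; rewrite !inE => uU u'U.
suff cc : c = c' by move: e; rewrite cc => /addIr->.
apply/eqP; rewrite -subr_eq0; apply: contraNT vU => cc.
rewrite -[v](scalerK cc) memvZ // scalerBl.
have -> : c *: v - c' *: v = u' - u by apply/eqP; rewrite subr_eq addrAC -e addrAC subrr add0r.
by rewrite memvB.
Qed.

(* The subspaces of the covering all contain [0], so fewer than [#|F| + 1] of
   them are too small to cover the nonzero vectors. *)
Lemma covering_card (F : finFieldType) k (C : seq {vspace 'rV[F]_k}) :
  (forall U, U \in C -> U != fullv) ->
  (forall v : 'rV[F]_k, exists2 U, U \in C & v \in U) -> (#|F| < size C)%N.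
Proof.
move=> proper cover; rewrite ltnNge; apply/negP => sC.
set n := #|{: 'rV[F]_k}|; have q2 : (1 < #|F|)%N := finNzRing_gt1 F.
pose S (U : {vspace 'rV[F]_k}) := [set x | x \in U].
have S0 U : #|S U :\ 0| = #|S U|.-1.
  by rewrite (cardsD1 0 (S U)) inE mem0v.
have cs (A : {set 'rV[F]_k}) : #|A| = (\sum_x (x \in A))%N.
  by rewrite -sum1_card big_mkcond; apply: eq_bigr => x _; case: (x \in A).
have le : (n.-1 <= \sum_(U <- C) #|S U :\ 0%R|)%N.
  rewrite /n -cardsT (cardsD1 0) inE /= cs.
  under [leqRHS]eq_bigr do rewrite cs.
  rewrite exchange_big /=; apply: leq_sum => x _.
  have [U UC xU] := cover x; rewrite (big_rem U) //= !inE xU.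
  by case: (x == 0).
have [U0 U0C _] := cover 0.
have nq : (#|F| <= n)%N.
  apply: leq_trans (card_proper_vspace (proper _ U0C)); rewrite leq_pmull //.
  by apply/card_gt0P; exists 0; rewrite inE mem0v.
(* Each [U] has at most [n / #|F| - 1] nonzero vectors. With at most [#|F|] subspaces this gives
   [n - 1 <= n - #|F|], against [1 < #|F|]. *)
have : (n.-1 * #|F| <= size C * (n - #|F|))%N.
  apply: (@leq_trans ((\sum_(U <- C) #|S U :\ 0%R|) * #|F|)); first by rewrite leq_mul2r le orbT.
  rewrite big_distrl /= -sum1_size big_distrl /= big_seq [leqRHS]big_seq.
  apply: leq_sum => U UC; rewrite S0 mul1n -subn1 mulnBl mul1n leq_sub2r //.
  exact: card_proper_vspace (proper _ UC).
move/leq_trans/(_ (leq_mul sC (leqnn _))); nia.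
Qed.

(** * Deduction of the corollary *)

Local Open Scope fset_scope.

Lemma contains_power_mod_Fp q (B : {fset int}) p : prime p -> contains_power_mod q B p ->
  exists2 b, b \in B & exists z : 'F_p, z ^+ q = b%:~R.
Proof.
move=> pp [b bB [x /eqP]]; rewrite eqz_mod_dvd => px; exists b => //; exists x%:~R.
by apply/eqP; rewrite -rmorphXn /= -subr_eq0 -rmorphB /= intr_Fp_eq0.
Qed.

Theorem corollary1 (q : nat) (q_prime : prime q) (q_odd : odd q)
    (B : {fset int}) (B_nonzero : 0 \notin B) (card_B : (#|` B| < q.+1)%N) :
  ([\/ for_almost_every_prime (contains_power_mod q B),
       (forall p : nat, prime p -> p <> q ->
          ~~ (p %| \prod_(b <- enum_fset B) b)%Z -> contains_power_mod q B p)
     | (2 <= assoc_dim q B)%N /\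
         contains_linear_covering (assoc_hyperplanes q B)] ->
   contains_perfect_power q B)
  /\
  (for_almost_every_prime (contains_power_mod q B) <->
   contains_perfect_power q B).
Proof.
have hard : for_almost_every_prime (contains_power_mod q B) -> contains_perfect_power q B.
  case=> S HS; apply: contrapT => nB.
  have [|b bB|p [pp yp Hp]] :=
    @prime_without_power q (enum_fset B) (\max_(p <- enum_fset S) p).+1 q_prime.
  - by rewrite -ltnS.
  - split=> [|d bd]; first by apply: contraNneq B_nonzero => <-.
    by apply: nB; exists b => //; exists d.
  have pS : p \notin S.
    apply/negP => pS; have : (p <= \max_(r <- enum_fset S) r)%N by apply: leq_bigmax_seq.
    by rewrite leqNgt yp.
  have [b bB [z zb]] := contains_power_mod_Fp pp (HS p pp pS).
  exact: Hp zb.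
split; last first.
  split=> // -[b bB [d bd]]; exists fset0 => p _ _; exists b => //; exists d.
  by rewrite bd.
case=> [//|all_p|[k2 [C CH [_ proper cover]]]].
  (* Condition (2) fails to speak only of [q] and of the prime divisors of the product, a finite
     set. *)
  apply: hard; exists (q |` [fset p in primes (absz (\prod_(b <- enum_fset B) b)%R)]) => p pp.
  rewrite !inE negb_or => /andP[/eqP pq np]; apply: all_p => //.
  have P0 : (\prod_(b <- enum_fset B) b)%R != 0.
    by rewrite prodf_seq_neq0; apply/allP => b bB /=; apply: contraNneq B_nonzero => <-.
  by move: np; rewrite mem_primes pp absz_gt0 P0 dvdzE.
have := @covering_card _ _ (enum_fset C) proper cover.
rewrite card_Fp // ltnNge => /negP[]; rewrite -ltnS; apply: leq_ltn_trans card_B.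
apply: leq_trans (fsubset_leq_card CH) _; exact: leq_imfset_card.
Qed.
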